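(* Let $d\ge 1$ be an integer, let $r>1$, and let $(a_n)_{n\in\mathbb{N}}$ be a sequence of positive integers with $a_{n+1}\ge r a_n$ for every $n\in\mathbb{N}$. Let $\mu$ be a Borel probability measure on $[0,1]^d$ and assume that there are constants $\Upsilon>0$ and $A>0$ such that $$|(\mathcal{F}\mu)(\mathbf{x})|\le A\,(1+\|\mathbf{x}\|)^{-\Upsilon}\qquad\text{for all }\mathbf{x}\in\mathbb{R}^d .$$ Then there is a constant $C>0$, depending only on $d$, $r$ and $\Upsilon$, such that for $\mu$-almost every $\boldsymbol{\alpha}\in[0,1]^d$ there exists $N_0\in\mathbb{N}$ with the following property: for all integers $N\ge N_0$, every convex body $\mathcal{C}\subset[0,1]^d$ with volume $\mathrm{Vol}(\mathcal{C})\ge C(\log N)^2/N$ contains at least one point of the set $\{\boldsymbol{\alpha}a_n \bmod \mathbf{1} : 1\le n\le N\}$.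
   Context: The Fourier transform of $\mu$ is $(\mathcal{F}\mu)(\mathbf{x})=\int_{[0,1]^d}e^{2\pi i\,\mathbf{x}\cdot\boldsymbol{\xi}}\,d\mu(\boldsymbol{\xi})$ for $\mathbf{x}\in\mathbb{R}^d$, where $\cdot$ is the Euclidean inner product. $\|\cdot\|$ is any fixed norm on $\mathbb{R}^d$ (the choice is immaterial since all norms are equivalent). A convex body is a compact convex set, and $\mathrm{Vol}$ is the $d$-dimensional Lebesgue measure. For $\boldsymbol{\alpha}=(\alpha_1,\dots,\alpha_d)$, $\boldsymbol{\alpha}a_n \bmod \mathbf{1}$ denotes the point of $[0,1)^d$ whose $i$-th coordinate is the fractional part of $\alpha_i a_n$. *)

(* Defs.v *)
From HB Require Import structures.
From mathcomp Require Import all_boot all_order all_algebra.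
From mathcomp Require Import all_classical all_reals all_analysis.
From mathcomp Require Import complex.

Set Implicit Arguments.
Unset Strict Implicit.
Unset Printing Implicit Defensive.

Import Order.TTheory GRing.Theory Num.Theory.
Import numFieldNormedType.Exports.

Local Open Scope classical_set_scope.
Local Open Scope ring_scope.

Section Lebesgue.
Context {R : realType}.
Local Notation RL := (measurableTypeR R).

Section cons_measure.
Context {n : nat} (m : {sigma_finite_measure set (n.-tuple RL) -> \bar R}).

Definition tcons (p : RL * n.-tuple RL) : n.+1.-tuple RL :=
  [tuple of p.1 :: p.2].

Lemma measurable_tcons : measurable_fun setT tcons.
Proof. exact: measurable_cons measurable_fst measurable_snd. Qed.

(* The product of the Lebesgue measure on R with m, carried to (n+1)-tuples. *)
Definition cons_measure : set (n.+1.-tuple RL) -> \bar R :=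
  pushforward (@lebesgue_measure R \x m)%E tcons.

Let cons_measure0 : cons_measure set0 = 0%E.
Proof. by rewrite /cons_measure /pushforward preimage_set0 measure0. Qed.

Let cons_measure_ge0 A : (0 <= cons_measure A)%E.
Proof. exact: (measure_ge0 (@lebesgue_measure R \x m)%E). Qed.

Let cons_measure_sigma_additive : semi_sigma_additive cons_measure.
Proof.
move=> F mF tF mUF; rewrite /cons_measure /pushforward preimage_bigcup.
apply: measure_semi_sigma_additive.
- move=> k; rewrite -[X in measurable X]setTI; exact: measurable_tcons.
- apply/trivIsetP => i j _ _ ij; rewrite -preimage_setI.
  by move/trivIsetP : tF => /(_ _ _ _ _ ij) ->//; rewrite preimage_set0.
- rewrite -preimage_bigcup -[X in measurable X]setTI; exact: measurable_tcons.
Qed.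

HB.instance Definition _ := isMeasure.Build _ _ _ cons_measure
  cons_measure0 cons_measure_ge0 cons_measure_sigma_additive.

Let cons_measure_sigma_finite : sigma_finite setT cons_measure.
Proof.
have /sigma_finiteP[F [TF ndF Foo]] := sigma_finiteT (@lebesgue_measure R).
have /sigma_finiteP[G [TG ndG Goo]] := sigma_finiteT m.
pose g (t : n.+1.-tuple RL) : RL * n.-tuple RL := (thead t, [tuple of behead t]).
have mg : measurable_fun setT g.
  apply/measurable_fun_pair; first exact: measurable_tnth.
  exact: measurable_behead.
have gK : g \o tcons = id.
  by apply/funext => -[x t]; rewrite /g /= theadE; congr pair; exact/val_inj.
exists (fun k => g @^-1` (F k `*` G k)).
  rewrite -preimage_bigcup (_ : \bigcup_k _ = setT)//.
  apply/seteqP; split => // -[x y] _.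
  have [i _ Fix] : (\bigcup_k F k) x by rewrite -TF.
  have [j _ Gjy] : (\bigcup_k G k) y by rewrite -TG.
  exists (maxn i j) => //; split.
  - by move: x Fix; exact/subsetPset/ndF/leq_maxl.
  - by move: y Gjy; exact/subsetPset/ndG/leq_maxr.
move=> k; have [mF Fk] := Foo k; have [mG Gk] := Goo k.
split; first by rewrite -[X in measurable X]setTI; apply: mg => //; exact: measurableX.
rewrite /cons_measure /pushforward -comp_preimage gK preimage_id.
by rewrite product_measure1E// lte_mul_pinfty// ge0_fin_numE.
Qed.

HB.instance Definition _ := Measure_isSigmaFinite.Build _ _ _ cons_measure
  cons_measure_sigma_finite.

End cons_measure.

Fixpoint lebesgue_tuple n : {sigma_finite_measure set (n.-tuple RL) -> \bar R} :=
  if n is n'.+1 then cons_measure (lebesgue_tuple n') else dirac [tuple].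

Lemma lebesgue_tuple_box n (a b : 'I_n -> R) : (forall i, a i <= b i) ->
  lebesgue_tuple n [set t | forall i, a i <= tnth t i <= b i] =
  (\prod_(i < n) (b i - a i))%:E.
Proof.
elim: n a b => [|n IHn] a b ab.
  rewrite big_ord0 /= diracE mem_set//; by case.
pose B := [set t : n.-tuple RL |
  forall i, a (lift ord0 i) <= tnth t i <= b (lift ord0 i)].
have mB : measurable B.
  rewrite (_ : B = \bigcap_(i in [set: 'I_n]) ((fun t : n.-tuple RL => tnth t i)
      @^-1` `[a (lift ord0 i), b (lift ord0 i)])).
    apply: fin_bigcap_measurable; first exact: finite_finset.
    move=> i _; rewrite -[X in measurable X]setTI.
    exact: (measurable_tnth (T := RL) i measurableT (measurable_itv _)).
  by apply/seteqP; split => t /= H i; [move=> _|];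
    have := H i; rewrite /= in_itv/=; [|exact].
rewrite /= /cons_measure /pushforward.
rewrite (_ : _ @^-1` _ = `[a ord0, b ord0] `*` B); last first.
  apply/seteqP; split => [[x t] /= H|[x t] [/=]].
    split => /=; first by have := H ord0; rewrite in_itv.
    by move=> i; have := H (lift ord0 i); rewrite tnthS.
  rewrite in_itv/= => H1 H2 i; have [j ->|->//] := unliftP ord0 i.
  by rewrite tnthS; exact: H2.
rewrite product_measure1E; [|exact: (measurable_itv `[a ord0, b ord0])|exact: mB].
rewrite IHn//.
rewrite [X in (X * _)%E](lebesgue_measure_itv `[a ord0, b ord0])/= lte_fin
  big_ord_recl EFinM -EFinD.
case: ltgtP (ab ord0) => // -> _; by rewrite subrr.
Qed.

End Lebesgue.

(* The measure is built on tuples, where the library provides the product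
   sigma-algebra, and transported to row vectors along the identification of
   coordinates; compact sets are measurable for it. *)
Definition Vol {R : realType} {d} (K : set 'rV[R]_d) : \bar R :=
  lebesgue_tuple d [set t | K (\row_i tnth t i)].

Notation borelRV R d := (g_sigma_algebraType (@open 'rV[R]_d)).

Definition cube (R : realType) d : set 'rV[R]_d :=
  [set x | forall i, 0 <= x ord0 i <= 1].

Definition dot (R : realType) d (x y : 'rV[R]_d) : R :=
  \sum_(i < d) x ord0 i * y ord0 i.

(* expi t = e^(it) *)
Definition expi (R : realType) (t : R) : R[i] := (cos t +i* sin t)%C.

Definition Cintegral d (T : measurableType d) (R : realType)
    (mu : {measure set T -> \bar R}) (D : set T) (f : T -> R[i]) : R[i] :=
  (Rintegral mu D (fun x => complex.Re (f x)) +i*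
   Rintegral mu D (fun x => complex.Im (f x)))%C.

Definition fourier (R : realType) d (mu : probability (borelRV R d) R)
    (x : 'rV[R]_d) : R[i] :=
  Cintegral mu (@cube R d) (fun xi => expi (2 * pi * dot x xi)).

Definition is_norm (R : realType) d (nrm : 'rV[R]_d -> R) : Prop :=
  [/\ forall x y, nrm (x + y) <= nrm x + nrm y,
      forall (c : R) x, nrm (c *: x) = `|c| * nrm x &
      forall x, nrm x = 0 -> x = 0].

(* A convex body may have empty interior, or be empty. *)
Definition convex_body (R : realType) d (K : set 'rV[R]_d) : Prop :=
  compact K /\ convex_set (K : set (convex_lmodType 'rV[R]_d)).

Definition frac (R : realType) (x : R) : R := x - (Num.floor x)%:~R.

Definition dilate_mod1 (R : realType) d (alpha : 'rV[R]_d) (m : nat) :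
    'rV[R]_d :=
  \row_i frac (alpha ord0 i * m%:R).

(* Main.v *)
(* Along the indices n_j = 1 + (j+1) l with l ~ c log N, consecutive a_{n_j} grow by a factor
   r^l, a large power of N. If g is a trigonometric polynomial with values in
   [0,1] and mean v, whose degree and coefficients are polynomial in N, then
   the Fourier decay of mu makes the g(a_{n_j} alpha) almost independent, so
   the expectation of prod_j (1 - g(a_{n_j} alpha)) is at most (1-v)^(N/l) up
   to a negative power of N. For v >= C (log N)^2 / N this is again a negative power of N.

   A convex body of volume V contains a sheared box of volume comparable to V
   (Fubini gives a large section; take the cone from a far point of the body
   over a box in that section). Boxes with coordinates rounded to multiples of
   a negative power of N form a family of polynomial size, and g is a smoothed
   indicator of such a box, built from the kernel cos(pi y)^(2m). Markov's
   inequality, a union bound over the family and the Borel-Cantelli lemma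
   conclude. *)

Require Import Defs.
From mathcomp Require Import all_boot all_order all_algebra.
From mathcomp Require Import all_classical all_reals all_analysis.
From mathcomp Require Import complex.
From mathcomp Require Import zify ring lra.

Set Implicit Arguments.
Unset Strict Implicit.
Unset Printing Implicit Defensive.

Import Order.TTheory GRing.Theory Num.Theory.
Import numFieldNormedType.Exports.

Local Open Scope classical_set_scope.
Local Open Scope ring_scope.

(** * Trigonometric polynomials *)

(** The obstacle is the size of coefficients: a product of [j] factors has coefficients of total
    size [(1 + H)^j], with [H] a power of [N], while decay gains only a power of the frequency. The
    gain wins because this frequency is itself of order at least [X^(j+1)] with [X = r^l]; it
    suffices that [X^Ups] exceeds [1 + H] times a power of [N], and this forces [l] of order
    [log N]. The gap costs one logarithm of the threshold, the union bound over the family the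
    other. The norm and [A] only multiply error terms, so [C] does not depend on them.

    Boxes are sheared because a thin slanted convex set contains no axis-parallel box of comparable
    volume. Slopes and inverse side lengths are at most a constant over the volume, which keeps the
    family polynomial.

    The translates of the normalised kernel by multiples of [1/(m+1)] sum exactly to 1. Hence [g]
    stays in [0,1] and its mean is exactly the normalised number of grid points; removing it leaves
    only nonzero integer frequencies, which dilation by [a_n] makes large. *)

Section trigonometric_polynomials.
Context {R : realType}.
Implicit Types (n : nat) (k x o : nat -> R) (Q : (nat -> R) -> Prop).
Implicit Types (f : (nat -> R) -> R) (H : R).

(* Points of R^n are the first n terms of a sequence, so that removing the
   first coordinate is a shift. *)
Definition inner n k x : R := \sum_(i < n) k i * x i.

Definition tail T (x : nat -> T) : nat -> T := fun i => x i.+1.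

Definition scons T (a : T) (x : nat -> T) : nat -> T :=
  fun i => if i is j.+1 then x j else a.

Lemma inner_shift n k x : inner n.+1 k x = k 0%N * x 0%N + inner n (tail k) (tail x).
Proof. by rewrite /inner big_ord_recl. Qed.

Lemma innerDl n k k' x : inner n (k + k') x = inner n k x + inner n k' x.
Proof. by rewrite /inner -big_split; apply: eq_bigr => i _ /=; rewrite -mulrDl. Qed.

Lemma innerBl n k k' x : inner n (k - k') x = inner n k x - inner n k' x.
Proof. by rewrite /inner -sumrB; apply: eq_bigr => i _; rewrite -mulrBl. Qed.

(* [tp n Q H f]: f is a trigonometric polynomial in n variables with
   frequencies in Q and with sum of absolute values of coefficients at most H;
   the real form, with phases, avoids complex coefficients. *)
Inductive tp n Q : R -> ((nat -> R) -> R) -> Prop :=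
| tp_cos k p : Q k -> tp n Q 1 (fun x => cos (2 * pi * inner n k x + p))
| tp0 : tp n Q 0 (fun=> 0)
| tp_lin a b H H' f g : tp n Q H f -> tp n Q H' g ->
    tp n Q (`|a| * H + `|b| * H') (fun x => a * f x + b * g x)
| tp_le H H' f : H <= H' -> tp n Q H f -> tp n Q H' f.

Lemma tp_ext n Q H f g : f =1 g -> tp n Q H f -> tp n Q H g.
Proof. by move=> /funext ->. Qed.

Lemma tp_ge0 n Q H f : tp n Q H f -> 0 <= H.
Proof.
elim=> // {H f}; last by move=> H H' f HH' _ H0; exact: le_trans HH'.
by move=> a b H H' f g _ H0 _ H0'; rewrite addr_ge0// mulr_ge0.
Qed.

Lemma tp_norm n Q H f x : tp n Q H f -> `|f x| <= H.
Proof.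
elim=> {H f}.
- by move=> k p _; rewrite cos_max.
- by rewrite normr0.
- move=> a b H H' f g _ IH _ IH'; rewrite (le_trans (ler_normD _ _))// !normrM.
  by rewrite lerD// ler_wpM2l.
- by move=> H H' f HH' _ IH; exact: le_trans HH'.
Qed.

Lemma tp_add n Q H H' f g : tp n Q H f -> tp n Q H' g ->
  tp n Q (H + H') (fun x => f x + g x).
Proof.
move=> Hf Hg; have := tp_lin 1 1 Hf Hg; rewrite normr1 !mul1r.
by apply: tp_ext => x; rewrite !mul1r.
Qed.

Lemma tp_scale n Q H f a : tp n Q H f -> tp n Q (`|a| * H) (fun x => a * f x).
Proof.
move=> Hf; have := tp_lin a 0 Hf (tp0 n Q); rewrite mulr0 addr0.
by apply: tp_ext => x; rewrite mulr0 addr0.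
Qed.

Lemma tp_sum n Q H m (f : nat -> (nat -> R) -> R) :
  (forall i, (i < m)%N -> tp n Q H (f i)) ->
  tp n Q (m%:R * H) (fun x => \sum_(i < m) f i x).
Proof.
elim: m => [_|m IH Hf].
  by rewrite mul0r; apply: tp_ext (tp0 _ _) => x; rewrite big_ord0.
rewrite -natr1 mulrDl mul1r.
apply: tp_ext (tp_add (IH (fun i im => Hf i (ltnW im))) (Hf m (ltnSn m))) => x.
by rewrite big_ord_recr.
Qed.

Lemma tp_sub n Q Q' H f : (forall k, Q k -> Q' k) -> tp n Q H f -> tp n Q' H f.
Proof.
move=> QQ'; elim=> {H f}.
- by move=> k p /QQ'; exact: tp_cos.
- exact: tp0.
- by move=> a b H H' f g _ Hf _; exact: tp_lin.
- by move=> H H' f HH' _; exact: tp_le.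
Qed.

Lemma tp_comp n n' Q Q' H f (h : (nat -> R) -> nat -> R) :
  (forall k, Q k -> exists2 k', Q' k' &
     exists p, forall x, inner n k (h x) = inner n' k' x + p) ->
  tp n Q H f -> tp n' Q' H (fun x => f (h x)).
Proof.
move=> hQ; elim=> {H f}.
- move=> k p /hQ[k' Qk' [p' E]].
  apply: tp_ext (tp_cos _ (2 * pi * p' + p) Qk') => x.
  by rewrite E; congr cos; ring.
- exact: tp0.
- by move=> a b H H' f g _ Hf _; exact: tp_lin.
- by move=> H H' f HH' _; exact: tp_le.
Qed.

Lemma tp_cst n Q c : Q 0 -> tp n Q `|c| (fun=> c).
Proof.
move=> Q0; have := tp_scale c (tp_cos n 0 Q0); rewrite mulr1.
apply: tp_ext => x; rewrite addr0 /inner big1 ?mulr0 ?cos0 ?mulr1//.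
by move=> i _; rewrite mul0r.
Qed.

(** By the product-to-sum formula a product of two cosines is half the sum of two cosines, so the
    coefficient bounds multiply without loss. *)
Lemma tp_mul n Q Q' Q'' H H' f g :
  (forall k k', Q k -> Q' k' -> Q'' (k + k') /\ Q'' (k - k')) ->
  tp n Q H f -> tp n Q' H' g -> tp n Q'' (H * H') (fun x => f x * g x).
Proof.
move=> QQ Hf; elim: Hf H' g => {H f}.
- move=> k p Qk H' g Hg; elim: Hg => {H' g}.
  + move=> k' p' Qk'; have [Q1 Q2] := QQ _ _ Qk Qk'.
    have := tp_lin 2^-1 2^-1 (tp_cos n (p + p') Q1) (tp_cos n (p - p') Q2).
    rewrite (_ : `|2^-1| * 1 + `|2^-1| * 1 = 1 * 1 :> R); last by rewrite ger0_norm ?invr_ge0//; field.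
    apply: tp_ext => x.
    rewrite innerDl innerBl.
    set u := inner n k x; set v := inner n k' x.
    rewrite (_ : 2 * pi * (u + v) + (p + p') =
      (2 * pi * u + p) + (2 * pi * v + p')); last by ring.
    rewrite (_ : 2 * pi * (u - v) + (p - p') =
      (2 * pi * u + p) - (2 * pi * v + p')); last by ring.
    by rewrite cosD cosB; field.
  + by rewrite mulr0; apply: tp_ext (tp0 _ _) => x; rewrite mulr0.
  + move=> a b H H' f g _ IH1 _ IH2.
    have := tp_lin a b IH1 IH2; rewrite !mul1r.
    by apply: tp_ext => x; ring.
  + by move=> H H' f HH' _; rewrite !mul1r; exact: tp_le.
- by move=> H' g Hg; rewrite mul0r; apply: tp_ext (tp0 _ _) => x; rewrite mul0r.
- move=> a b H1 H2 f1 f2 _ IH1 _ IH2 H' g Hg.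
  have := tp_lin a b (IH1 _ _ Hg) (IH2 _ _ Hg); rewrite !mulrA -mulrDl.
  by apply: tp_ext => x; ring.
- move=> H1 H2 f H12 _ IH H' g Hg; apply: tp_le (IH _ _ Hg).
  by rewrite ler_wpM2r// (tp_ge0 Hg).
Qed.

Definition nonzero n k := exists2 i, (i < n)%N & k i != 0.

(** The terms of frequency zero are constants and go into [b]. Its value is read off later, by
    averaging over shifts with [tp_sum_shift0]. *)
Lemma tp_split n Q H f : tp n Q H f ->
  exists b, tp n (fun k => Q k /\ nonzero n k) H (fun x => f x - b).
Proof.
elim=> {H f}.
- move=> k p Qk; have [nzk|k0] := pselect (nonzero n k).
    by exists 0; apply: tp_ext (tp_cos _ p _) => [x|]; [rewrite subr0|split].
  exists (cos p); apply: (@tp_le _ _ 0 1) => //.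
  apply: tp_ext (tp0 _ _) => x; rewrite /inner big1 ?mulr0 ?add0r ?subrr//.
  move=> i _; have [->|ki] := eqVneq (k i) 0; first by rewrite mul0r.
  by exfalso; apply: k0; exists i.
- by exists 0; apply: tp_ext (tp0 _ _) => x; rewrite subrr.
- move=> a b H H' f g _ [c1 IH1] _ [c2 IH2]; exists (a * c1 + b * c2).
  by apply: tp_ext (tp_lin a b IH1 IH2) => x; ring.
- by move=> H H' f HH' _ [b IH]; exists b; exact: tp_le IH.
Qed.

Definition integral_freq m n k :=
  forall i, (i < n)%N -> exists2 z : int, k i = z%:~R & `|k i| <= m%:R.

End trigonometric_polynomials.

(** * The kernel and the discretised indicator functions *)

Section kernel.
Context {R : realType}.

Lemma periodicz (f : R -> R) T (z : int) x : periodic f T -> f (x + T *~ z) = f x.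
Proof.
move=> fT; case: z => n; first by rewrite -pmulrn periodicn.
by rewrite NegzE mulrNz -pmulrn -[LHS](periodicn fT n.+1) subrK.
Qed.

(** A nonzero integer of absolute value at most [m < q] is not a multiple of [q], so averaging over
    the shifts by multiples of [1/q] annihilates each such frequency. *)
Lemma tp_sum_shift0 m q H (f : (nat -> R) -> R) (x : nat -> R) : (m < q)%N ->
  tp 1 (fun k => integral_freq m 1 k /\ nonzero 1 k) H f ->
  \sum_(t < q) f (fun i => x i - t%:R / q%:R) = 0.
Proof.
move=> mq; have q0 : (0 < q%:R :> R) by rewrite ltr0n (leq_ltn_trans _ mq).
elim=> {H f}.
- move=> k p [km [[] // _ k0]]; have [z kz zm] := km 0%N isT.
  rewrite /inner.
  pose h := 2 * pi * k 0%N / q%:R; set th := 2 * pi * (k 0%N * x 0%N) + p.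
  pose u t := - sin (th - t%:R * h + h / 2).
  have sin0 : sin (h / 2) != 0.
    have E : h / 2 = pi * (k 0%N / q%:R) by rewrite /h; field; rewrite gt_eqF.
    have pos c : 0 < c -> c < q%:R -> 0 < sin (pi * (c / q%:R) : R).
      move=> c0 cq; apply: sin_gt0_pi; rewrite mulr_gt0 ?pi_gt0 ?divr_gt0//=.
      by rewrite gtr_pMr ?pi_gt0// ltr_pdivrMr// mul1r.
    have kq : `|k 0%N| < q%:R by rewrite (le_lt_trans zm)// ltr_nat.
    rewrite E; case: (ltgtP (k 0%N) 0) k0 => // [kneg|kpos] _.
      rewrite -[k _]opprK mulNr mulrN sinN oppr_eq0 gt_eqF// pos ?oppr_gt0//.
      by move: kq; rewrite ltr0_norm.
    by rewrite gt_eqF// pos//; move: kq; rewrite gtr0_norm.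
  (* Multiplied by [2 * sin (h / 2)], the sum telescopes. *)
  have two0 : 2 != 0 :> R by [].
  apply: (mulfI (mulf_neq0 two0 sin0)); rewrite mulr0 mulr_sumr.
  transitivity (\sum_(t < q) (u t.+1 - u t)).
    apply: eq_bigr => t _.
    rewrite big_ord1 (_ : 2 * pi * (k 0%N * (x 0%N - t%:R / q%:R)) + p = th - t%:R * h);
      last by rewrite /th /h; ring.
    rewrite /u (_ : th - t.+1%:R * h + h / 2 = th - t%:R * h - h / 2); last first.
      by rewrite -natr1; field.
    by move: (th - _) => w; rewrite sinB sinD; ring.
  rewrite -(big_mkord xpredT (fun t => u t.+1 - u t)) telescope_sumr//.
  suff -> : u q = u 0%N by rewrite subrr.
  rewrite /u mul0r subr0; congr (- _); rewrite -[RHS](periodicz (- z) _ (@sinD2pi R)).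
  congr sin; rewrite mulrNz -mulrzr -kz /h -mulr_natr.
  by field; rewrite gt_eqF.
- by rewrite big1.
- move=> a b H H' f g _ IH _ IH'.
  by rewrite big_split /= -!mulr_sumr IH IH' !mulr0 addr0.
- by [].
Qed.

(** The left side is [cos(pi y)^2], so the claim is [sin(pi y)^2 >= 2 y^2]. Up to [pi / 4] the mean
    value theorem gives [sin z >= z cos(pi / 4)], and [pi >= 2] concludes; beyond,
    [sin(pi / 4)^2 = 1/2 >= 2 y^2]. *)
Lemma cos_quadratic_bound (y : R) : 0 <= y <= 1 / 2 -> (1 + cos (2 * pi * y)) / 2 <= 1 - 2 * y ^+ 2.
Proof.
move=> /andP[y0 y2]; pose z := pi * y.
have -> : (1 + cos (2 * pi * y)) / 2 = 1 - sin z ^+ 2.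
  rewrite (_ : 2 * pi * y = z *+ 2) ?cos_mulr2n ?cos2sin2 ?/z; last by ring.
  by rewrite mulr2n; field.
suff : 2 * y ^+ 2 <= sin z ^+ 2 by lra.
have pi0 : 0 < pi :> R by exact: pi_gt0.
have c2 : cos (pi / 4) ^+ 2 = 1 / 2 :> R.
  have := @cos_mulr2n R (pi / 4); rewrite (_ : pi / 4 *+ 2 = pi / 2); last by field.
  by rewrite cos_pihalf mulr2n; lra.
have s2 : sin (pi / 4) ^+ 2 = 1 / 2 :> R by rewrite sin2cos2 c2; field.
have c0 : 0 <= cos (pi / 4) :> R by apply: cos_ge0_pihalf; lra.
have s0 : 0 <= sin (pi / 4) :> R by apply: sin_ge0_pi; lra.
have z0 : 0 <= z by rewrite mulr_ge0// ltW.
have zpi : z <= pi / 2 by rewrite ler_pM2l// -[leRHS]mul1r.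
have [z4|z4] := leP z (pi / 4); last first.
  have : sin (pi / 4) <= sin z.
    rewrite leNgt ltr_sin ?in_itv/=; [by rewrite -leNgt ltW |lra|lra].
  move=> h; apply: (@le_trans _ _ (sin (pi / 4) ^+ 2)).
    by rewrite s2; nra.
  by rewrite lerXn2r ?nnegrE// (le_trans s0).
have [|c] := @MVT_segment R sin cos 0 z z0.
  exact/continuous_subspaceT/continuous_sin.
rewrite in_itv/= sin0 !subr0 => /andP[c0' cz] ->.
have : cos (pi / 4) <= cos c.
  rewrite leNgt ltr_cos ?in_itv/=; [|lra..].
  by rewrite -leNgt (le_trans cz).
move=> cc; have {}cc : 1 / 2 <= cos c ^+ 2 by rewrite -c2 lerXn2r ?nnegrE ?(le_trans c0).
have z2 : 4 * y ^+ 2 <= z ^+ 2.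
  by rewrite /z exprMn ler_wpM2r ?sqr_ge0//; have := @pi_ge2 R; nra.
by rewrite exprMn; nra.
Qed.

Lemma frac_cos_bound m (rho y : R) : 0 <= rho ->
  (forall k : int, rho < `|y - k%:~R|) ->
  ((1 + cos (2 * pi * y)) / 2) ^+ m <= (1 - 2 * rho ^+ 2) ^+ m.
Proof.
move=> rho0 far; pose k := Num.floor (y + 1 / 2); pose w := y - k%:~R.
have /andP[fl fr] := real_floor_itv (num_real (y + 1 / 2)).
have wI : `|w| <= 1 / 2.
  by rewrite ler_norml /w /k; move: fl fr; rewrite intrD; lra.
have -> : cos (2 * pi * y) = cos (2 * pi * `|w|).
  transitivity (cos (2 * pi * w)).
    rewrite -(periodicz (- k) _ (@cosD2pi R)); congr cos.
    by rewrite mulrNz -mulrzr -mulr_natr /w; ring.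
  by case: (ger0P w) => // _; rewrite mulrN cosN.
apply: lerXn2r; rewrite ?nnegrE.
- by rewrite divr_ge0// -lerBlDl sub0r cos_geN1.
- have := far k; rewrite -/w => rw.
  have := sqr_ge0 rho; nra.
- apply: le_trans (cos_quadratic_bound _) _; first by rewrite normr_ge0.
  by have := far k; rewrite -/w => rw; nra.
Qed.

(** The kernel is [cos(pi y)^(2m)] divided by the sum of its [m + 1] shifts, which is constant since
    its frequencies are integers of size at most [m]. *)
Lemma kernel_exists (m : nat) : exists F : R -> R, [/\
  forall y, 0 <= F y,
  forall y, \sum_(t < m.+1) F (y - t%:R / m.+1%:R) = 1,
  tp 1 (fun k => integral_freq m 1 k /\ nonzero 1 k) 1
     (fun x => F (x 0%N) - m.+1%:R^-1) &
  forall rho y, 0 <= rho -> (forall k : int, rho < `|y - k%:~R|) ->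
     F y <= (1 - 2 * rho ^+ 2) ^+ m].
Proof.
pose c1 (y : R) := (1 + cos (2 * pi * y)) / 2.
have c1_ge0 y : 0 <= c1 y by rewrite divr_ge0// -lerBlDl sub0r cos_geN1.
have tpc n : tp 1 (integral_freq n 1) 1 (fun x => c1 (x 0%N) ^+ n).
  elim: n => [|n IH].
    have := @tp_cst R 1 (integral_freq 0 1) 1; rewrite normr1; apply.
    by move=> i _; exists 0; rewrite ?normr0.
  have h1 : tp 1 (integral_freq 1 1) 1 (fun x => c1 (x 0%N)).
    have hc : tp 1 (integral_freq 1 1) 1 (fun x : nat -> R => cos (2 * pi * inner 1 (fun=> 1) x + 0)).
      by apply: tp_cos => i _; exists 1; rewrite ?normr1.
    have h0 := @tp_cst R 1 (integral_freq 1 1) 1 _.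
    have := tp_lin 2^-1 2^-1 (h0 _) hc.
    rewrite (_ : _ + _ = 1); last by rewrite normr1 ger0_norm ?invr_ge0//; field.
    apply: (fun h h' => tp_ext h (h' _)) => [i _|x]; first by exists 0; rewrite ?normr0.
    by rewrite /inner big_ord1 mul1r addr0 /c1; field.
  rewrite -[1 in X in tp _ _ X _]mulr1.
  apply: tp_ext (tp_mul _ IH h1) => [x|k k' Qk Qk']; first by rewrite exprSr.
  split=> i i1; have [z kz kn] := Qk i i1; have [z' kz' kn'] := Qk' i i1.
  - exists (z + z'); first by rewrite intrD -kz -kz'.
    by rewrite -natr1 (le_trans (ler_normD _ _))// lerD.
  - exists (z - z'); first by rewrite intrB -kz -kz'.
    by rewrite -natr1 (le_trans (ler_normB _ _))// lerD.
have [b tpb] := tp_split (tpc m).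
pose q : R := m.+1%:R; have q0 : 0 < q by rewrite ltr0n.
have sumE y : \sum_(t < m.+1) c1 (y - t%:R / q) ^+ m = q * b.
  have := @tp_sum_shift0 m m.+1 _ _ (fun=> y) (ltnSn m) tpb.
  by rewrite /= sumrB sumr_const card_ord => /eqP; rewrite subr_eq0 /q mulr_natl => /eqP.
have c10 : c1 0 = 1 by rewrite /c1 mulr0 cos0; field.
(* At 0 the shift [t = 0] contributes 1 and the others are nonnegative. So the normalisation divides
   by at least 1 and increases neither the coefficients nor the tail. *)
have qb1 : 1 <= q * b.
  rewrite -(sumE 0) big_ord_recl mul0r subr0 c10 expr1n.
  by rewrite lerDl sumr_ge0// => i _; rewrite exprn_ge0.
have qb0 : 0 < q * b by exact: lt_le_trans qb1.
exists (fun y => c1 y ^+ m / (q * b)); split.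
- by move=> y; rewrite divr_ge0 ?exprn_ge0// ltW.
- by move=> y; rewrite -mulr_suml sumE divff// gt_eqF.
- have := tp_scale (q * b)^-1 tpb; rewrite mulr1 ger0_norm ?invr_ge0 1?ltW// => h.
  apply: tp_le (tp_ext _ h) => [|x]; first by rewrite invf_le1.
  field; apply/andP; split; rewrite gt_eqF//.
  by move: qb0; rewrite pmulr_rgt0.
- move=> rho y rho0 far; apply: le_trans (frac_cos_bound m rho0 far).
  by rewrite ler_pdivrMr// ler_peMr// exprn_ge0.
Qed.

End kernel.

Section discretisation.
Context {R : realType}.
Variables (F : R -> R) (m : nat).
Local Notation q := m.+1.
Implicit Types (L : nat -> nat) (W : nat -> nat -> R) (x : nat -> R).

(* A smoothed indicator, with values in [0,1], of the points
   (t_0/q, t_1/q + (t_0/q) W_00, ...) with 0 <= t_i < L_i, taken modulo 1. *)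
Fixpoint disc n L W x : R :=
  if n is n'.+1 then
    \sum_(t < L 0%N) F (x 0%N - t%:R / q%:R) *
      disc n' (tail L) (tail W) (fun i => tail x i - t%:R / q%:R * W 0%N i)
  else 1.

(** The recursion of [disc] with closeness in place of [F]. There is no reduction modulo 1 here;
    integer translations are left to [disc_gt_near]. *)
Fixpoint near_disc rho n L W x : Prop :=
  if n is n'.+1 then
    exists2 t : nat, (t < L 0%N)%N & `|x 0%N - t%:R / q%:R| <= rho /\
      near_disc rho n' (tail L) (tail W) (fun i => tail x i - t%:R / q%:R * W 0%N i)
  else True.

Hypothesis F0 : forall y, 0 <= F y.
Hypothesis sumF : forall y, \sum_(t < q) F (y - t%:R / q%:R) = 1.

Lemma sum_kernel_le1 l y : (l <= q)%N -> \sum_(t < l) F (y - t%:R / q%:R) <= 1.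
Proof.
move=> lq; rewrite -[leRHS](sumF y).
rewrite (big_ord_widen _ (fun t => F (y - t%:R / q%:R)) lq).
by rewrite [leRHS](bigID (fun t : 'I_q => (t < l)%N)) /= lerDl sumr_ge0.
Qed.

Lemma disc_ge0 n L W x : 0 <= disc n L W x.
Proof.
elim: n L W x => [|n IH] L W x /=; first exact: ler01.
by apply: sumr_ge0 => t _; rewrite mulr_ge0.
Qed.

Lemma disc_le1 n L W x : (forall i, (i < n)%N -> (L i <= q)%N) -> disc n L W x <= 1.
Proof.
elim: n L W x => [//|n IH] L W x Lq /=.
apply: le_trans (sum_kernel_le1 (x 0%N) (Lq 0%N isT)).
by apply: ler_sum => t _; rewrite ler_piMr// IH// => i; exact: (Lq i.+1).
Qed.

(** In dimension [n + 1], some [t] has both a large kernel value and a large inner value. Otherwise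
    the at most [q] terms with [F <= eps] add up to at most [q eps], and the others to at most
    [n q eps], because the shifts of [F] sum to at most 1. *)
Lemma disc_gt_near rho eps n L W x :
  0 <= eps ->
  (forall y, (forall k : int, rho < `|y - k%:~R|) -> F y <= eps) ->
  (forall i, (i < n)%N -> (L i <= q)%N) ->
  n%:R * (q%:R * eps) < disc n L W x ->
  exists2 y, near_disc rho n L W y &
    forall i, (i < n)%N -> exists k : int, x i = y i + k%:~R.
Proof.
move=> eps0 Feps; elim: n L W x => [|n IH] L W x Lq /=; first by exists x.
move=> big.
pose D t := disc n (tail L) (tail W) (fun i => tail x i - t%:R / q%:R * W 0%N i).
have [[t tL [Ft Dt]]|none] := pselect (exists2 t, (t < L 0)%N &
    eps < F (x 0%N - t%:R / q%:R) /\ n%:R * (q%:R * eps) < D t); last first.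
  exfalso; move: big; rewrite ltNge => /negP; apply.
  have L0q := Lq 0%N isT.
  apply: (@le_trans _ _ (\sum_(t < L 0%N)
      (n%:R * (q%:R * eps) * F (x 0%N - t%:R / q%:R) + eps))).
    apply: ler_sum => t _.
    have D1 : D t <= 1 by apply: disc_le1 => i; exact: (Lq i.+1).
    have D0 : 0 <= D t by exact: disc_ge0.
    have nq0 : 0 <= n%:R * (q%:R * eps) by rewrite mulr_ge0// mulr_ge0.
    have [Feq|Flt] := leP (F (x 0%N - t%:R / q%:R)) eps.
      rewrite (@le_trans _ _ eps)//; last by rewrite lerDr mulr_ge0.
      by rewrite (le_trans _ Feq)// ler_piMr.
    rewrite (@le_trans _ _ (n%:R * (q%:R * eps) * F (x 0%N - t%:R / q%:R)))//; last first.
      by rewrite lerDl.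
    rewrite mulrC ler_wpM2r// leNgt; apply/negP => Dt; apply: none.
    by exists t.
  rewrite big_split /= -mulr_sumr sumr_const card_ord -[n.+1%:R]natr1 mulrDl mul1r lerD//.
    by rewrite ler_piMr ?sum_kernel_le1// mulr_ge0// mulr_ge0.
  by rewrite mulr_natl ler_wpMn2l.
have [k kr] : exists k : int, `|x 0%N - t%:R / q%:R - k%:~R| <= rho.
  apply: contrapT => H; move: Ft; rewrite ltNge Feps// => k.
  by rewrite ltNge; apply/negP => ?; apply: H; exists k.
have [|y ny xy] := IH _ _ _ _ Dt; first by move=> i; exact: (Lq i.+1).
(* The shear is driven by the grid value [t / q], not by [x 0]: changing [x 0] by the integer [k]
   leaves the other coordinates untouched, although the slopes are not integers. *)
exists (scons (x 0%N - k%:~R) (fun i => y i + t%:R / q%:R * W 0%N i)).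
  exists t => //=; split; first by rewrite addrAC.
  rewrite (_ : (fun i => _) = y)//.
  by apply/funext => i /=; rewrite addrK.
move=> [_|i /= /(xy i)[k' /eqP]]; first by exists k; rewrite /= subrK.
rewrite subr_eq => /eqP xi; exists k'.
by rewrite -/(tail x i) xi addrAC.
Qed.

(** With [F = 1/q + F0'] and the inner factor [v + D], each term minus its mean [v / q] is
    [F0' D + v F0' + D / q]. The frequencies of [F0'] live in coordinate 0, those of [D] in the
    others, and neither has frequency zero, so no constant term arises. For [H = (3q)^n], each of
    the at most [q] terms costs [2H + 1 <= 3H]. *)
Lemma disc_tp n L W :
  tp 1 (fun k => integral_freq m 1 k /\ nonzero 1 k) 1 (fun x => F (x 0%N) - q%:R^-1) ->
  (forall i, (i < n)%N -> (L i <= q)%N) ->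
  tp n (fun k => integral_freq m n k /\ nonzero n k) ((3 * q%:R) ^+ n)
    (fun x => disc n L W x - \prod_(i < n) ((L i)%:R / q%:R)).
Proof.
move=> Ftp; have q0 : 0 < q%:R :> R by rewrite ltr0n.
elim: n L W => [|n IH] L W Lq /=.
  apply: (@tp_le _ _ _ 0); first by rewrite expr0.
  by apply: tp_ext (tp0 _ _) => x; rewrite big_ord0 subrr.
pose v := \prod_(i < n) ((tail L i)%:R / q%:R : R).
have v01 : 0 <= v <= 1.
  apply/andP; split; first by apply: prodr_ge0 => i _; rewrite divr_ge0.
  apply: prodr_ile1 => i _; rewrite divr_ge0//= ler_pdivrMr// mul1r ler_nat.
  by apply: (Lq i.+1); rewrite ltnS.
set Q := (fun k => _).
pose Q1 (k : nat -> R) := [/\ integral_freq m n.+1 k, k 0%N != 0 & tail k = 0].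
pose Q2 (k : nat -> R) := [/\ integral_freq m n.+1 k, k 0%N = 0 & nonzero n (tail k)].
have Q1Q k : Q1 k -> Q k by case=> ? ? _; split=> //; exists 0%N.
have Q2Q k : Q2 k -> Q k.
  by case=> ? _ [i ni ki]; split=> //; exists i.+1.
have Q12 k k' : Q1 k -> Q2 k' -> Q (k + k') /\ Q (k - k').
  move=> [k1 k2 k3] [k'1 k'2 k'3].
  have ki i : k i.+1 = 0 by rewrite -/(tail k i) k3.
  have pD i : (k + k') i = k i + k' i by [].
  have pB i : (k - k') i = k i - k' i by [].
  split; (split; last by exists 0%N => //; rewrite ?pD ?pB k'2 ?addr0 ?subr0) => -[|i] ni.
  - by have := k1 _ ni; rewrite pD k'2 addr0.
  - by have := k'1 _ ni; rewrite pD ki add0r.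
  - by have := k1 _ ni; rewrite pB k'2 subr0.
  - have [z zk zm] := k'1 _ ni; exists (- z); rewrite pB ki sub0r ?normrN//.
    by rewrite zk mulrNz.
pose s t : R := t%:R / q%:R.
pose F0' t (x : nat -> R) := F (x 0%N - s t) - q%:R^-1.
pose D t (x : nat -> R) :=
  disc n (tail L) (tail W) (fun i => tail x i - s t * W 0%N i) - v.
have F0tp t : tp n.+1 Q1 1 (F0' t).
  apply: (tp_comp (h := fun x => fun=> x 0%N - s t) _ Ftp) => k [km [[] // _ k0]].
  exists (scons (k 0%N) 0).
    split=> // -[|i] ni /=; first exact: km.
    by exists 0; rewrite ?normr0.
  exists (- (k 0%N * s t)) => x.
  rewrite !inner_shift /inner big_ord0 big1 => [|i _]; first by rewrite /=; ring.
  by rewrite /tail /= mul0r.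
have Dtp t : tp n.+1 Q2 ((3 * q%:R) ^+ n) (D t).
  have {}IH := IH (tail L) (tail W) (fun i => Lq i.+1).
  apply: (tp_comp (h := fun x => (fun i => tail x i - s t * W 0%N i)) _ IH).
  move=> k [km nk]; exists (scons 0 k).
    split=> // -[|i] ni /=; last exact: km.
    by exists 0; rewrite ?normr0.
  exists (- inner n k (fun i => s t * W 0%N i)) => x.
  rewrite inner_shift /= mul0r add0r.
  rewrite -[in RHS]mulN1r /inner mulr_sumr -big_split /=; apply: eq_bigr => i _.
  by rewrite /tail /=; ring.
have tptp t : tp n.+1 Q (2 * (3 * q%:R) ^+ n + 1)
    (fun x => F0' t x * D t x + (v * F0' t x + q%:R^-1 * D t x)).
  have h1 := tp_mul Q12 (F0tp t) (Dtp t).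
  have h2 := tp_lin v q%:R^-1 (tp_sub Q1Q (F0tp t)) (tp_sub Q2Q (Dtp t)).
  apply: tp_le (tp_add h1 h2).
  have H0 : 0 <= (3 * q%:R) ^+ n :> R by rewrite exprn_ge0// mulr_ge0.
  have /andP[v0 v1] := v01.
  have nq : `|q%:R^-1| = q%:R^-1 :> R by rewrite ger0_norm// invr_ge0 ltW.
  rewrite (ger0_norm v0) nq mul1r mulr1.
  have : q%:R^-1 * (3 * q%:R) ^+ n <= (3 * q%:R) ^+ n :> R.
    by rewrite ler_piMl// invf_le1// ler1n.
  move: (_ ^+ n) (_ * _ ^+ n) => H u; lra.
apply: tp_le (tp_ext _ (tp_sum (fun t (_ : (t < L 0%N)%N) => tptp t))) => [|x].
  have H1 : 1 <= (3 * q%:R) ^+ n :> R.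
    by rewrite exprn_ege1// -natrM ler1n.
  apply: (@le_trans _ _ (q%:R * (2 * (3 * q%:R) ^+ n + 1))).
    by rewrite ler_wpM2r ?ler_nat ?Lq//; lra.
  rewrite exprS; move: ((3 * q%:R) ^+ n) H1 => H H1; nra.
rewrite big_ord_recl -/v; set l := L ord0.
rewrite (eq_bigr (fun t : 'I_(L 0%N) => F (x 0%N - t%:R / q%:R) *
   disc n (tail L) (tail W) (fun i => tail x i - t%:R / q%:R * W 0%N i) - v / q%:R)).
  by rewrite sumrB sumr_const card_ord -mulr_natl; congr (_ - _); rewrite /l /=; ring.
by move=> t _; rewrite /F0' /D /s; ring.
Qed.

End discretisation.

(** * Sheared boxes in convex sets *)

Section sheared_boxes.
Context {R : realType}.
Implicit Types (l x o : nat -> R) (W : nat -> nat -> R) (L : nat -> nat).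

(** The image of the box with sides [l i] under a unitriangular map, hence of volume the product of
    the [l i]. The slope [W i j] is that of coordinate [i + j + 1] along side [i], whence the
    condition [(i + j).+1 < n] on slopes below. *)
Fixpoint sheared_box n l W x : Prop :=
  if n is n'.+1 then
    0 <= x 0%N <= l 0%N /\
    sheared_box n' (tail l) (tail W) (fun i => tail x i - x 0%N * W 0%N i)
  else True.

(** The point with box coordinates [l i / 4]: a grid of extent at most [l i / 2] starting there
    keeps a margin [l i / 4] on both sides. *)
Fixpoint sheared_center n l W : nat -> R :=
  if n is n'.+1 then
    scons (l 0%N / 4)
      (fun i => l 0%N / 4 * W 0%N i + sheared_center n' (tail l) (tail W) i)
  else 0.

(** Each coordinate multiplies the error [eta] by [2 (1 + B)]: an error [2 eta] in the first
    coordinate, times a slope at most [B], adds to the error of a later coordinate and to that of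
    its rounded slope, both at most [eta]. *)
Lemma near_disc_sheared_box m n l W L W' (B rho eta : R) x e :
  0 <= B -> 0 <= rho <= eta ->
  (forall i, (i < n)%N -> (L i <= m.+1)%N /\ (L i)%:R / m.+1%:R <= l i / 2) ->
  (forall i j, ((i + j).+1 < n)%N -> `|W i j| <= B /\ `|W i j - W' i j| <= rho) ->
  (forall i, (i < n)%N -> `|e i| <= eta) ->
  (forall i, (i < n)%N -> (2 * (1 + B)) ^+ n * eta * 2 <= l i / 4) ->
  near_disc m rho n L W' x ->
  sheared_box n l W (fun i => sheared_center n l W i + x i + e i).
Proof.
move=> B0; elim: n l W L W' eta x e => [//|n IH] l W L W' eta x e.
move=> /andP[rho0 rhoeta] HL HW He Hl [t tL [xt nx]].
have eta0 : 0 <= eta by exact: le_trans rhoeta.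
set q : R := m.+1%:R; have q0 : 0 < q by rewrite ltr0n.
have [L0m L0l] := HL 0%N isT.
have tl : t%:R / q <= l 0%N / 2.
  by apply: le_trans L0l; rewrite ler_pM2r ?invr_gt0// ler_nat ltnW.
have t1 : t%:R / q <= 1.
  by rewrite ler_pdivrMr// mul1r ler_nat (leq_trans (ltnW tL)).
have t0 : 0 <= t%:R / q by rewrite divr_ge0// ltW.
have e0 := He 0%N isT.
have B1 : 1 <= 2 * (1 + B) by lra.
split=> /=.
  have : 2 * eta <= l 0%N / 4.
    apply: le_trans (Hl 0%N isT).
    by rewrite mulrC ler_pM2r// ler_peMl// exprn_ege1.
  move: xt e0 tl t0; rewrite -/q !ler_norml; clear -rhoeta.
  move: (t%:R / q) => u /andP[? ?] /andP[? ?] ? ? ?.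
  by apply/andP; split; lra.
pose e' i := e i.+1 + t%:R / q * W' 0%N i - (x 0%N + e 0%N) * W 0%N i.
rewrite [X in sheared_box _ _ _ X](_ : _ = (fun i => sheared_center n (tail l) (tail W) i +
    (tail x i - t%:R / q * W' 0%N i) + e' i)); last first.
  by apply/funext => i; rewrite /tail /e' /=; ring.
apply: (IH _ _ (tail L) (tail W') (2 * (1 + B) * eta)) => //.
- by rewrite rho0 (le_trans rhoeta)// ler_peMl.
- by move=> i ni; exact: (HL i.+1).
- by move=> i j ij; exact: (HW i.+1).
- move=> i ni; have [WB WW] := HW 0%N i ni.
  rewrite /e' (_ : _ - _ = e i.+1 - t%:R / q * (W 0%N i - W' 0%N i) -
     (x 0%N - t%:R / q + e 0%N) * W 0%N i); last by ring.
  apply: (@le_trans _ _ (eta + eta + (2 * eta) * B)); last by nra.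
  apply: le_trans (ler_normB _ _) _; apply: lerD.
    apply: le_trans (ler_normB _ _) _; apply: lerD; first exact: (He i.+1).
    rewrite normrM (ger0_norm t0); apply: le_trans rhoeta.
    by apply: le_trans WW; rewrite ler_piMl.
  rewrite normrM ler_pM//.
  apply: le_trans (ler_normD _ _) _.
  by rewrite mulr2n mulrDl mul1r lerD// (le_trans xt).
- move=> i ni; apply: le_trans (Hl i.+1 ni).
  by rewrite exprSr !mulrA.
Qed.

Lemma sheared0 n l W : (forall i, (i < n)%N -> 0 <= l i) -> sheared_box n l W 0.
Proof.
elim: n l W => [//|n IH] l W l0 /=; split; first by rewrite lexx l0.
rewrite (_ : (fun i => _) = 0); first by apply: IH => i; exact: (l0 i.+1).
by apply/funext => i; rewrite /tail /= mul0r subrr.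
Qed.

Lemma sheared_scale n l W x (a b : R) : 0 <= a <= b -> 0 < b ->
  (forall i, (i < n)%N -> 0 <= l i) ->
  sheared_box n (fun i => a * l i) W x -> sheared_box n l W (fun i => x i / b).
Proof.
move=> /andP[a0 ab] b0; elim: n l W x => [//|n IH] l W x l0 [/andP[x0 xl] sx].
split=> /=.
  rewrite divr_ge0 ?(ltW b0)//= ler_pdivrMr// (le_trans xl)//.
  by rewrite mulrC ler_wpM2l// l0.
have := IH (tail l) (tail W) _ (fun i => l0 i.+1) sx.
rewrite (_ : (fun i => _) = (fun i => tail (fun i0 => x i0 / b) i - x 0%N / b * W 0%N i)) //.
by apply/funext => i; rewrite /tail /= ; ring.
Qed.

End sheared_boxes.

Section sheared_box_in_convex.
Context {R : realType}.
Local Notation RL := (measurableTypeR R).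
Local Open Scope ereal_scope.

Definition tup n (x : nat -> R) : n.-tuple RL := [tuple x i | i < n].

Lemma tupS n x : tup n.+1 x = tcons (x 0%N, tup n (tail x)).
Proof.
apply: eq_from_tnth => i; rewrite tnth_mktuple.
have [j ->|->] := unliftP ord0 i; last by rewrite (tnth_nth 0%R).
by rewrite tnthS tnth_mktuple.
Qed.

Lemma tup_nth n (z : n.-tuple RL) : tup n (fun i => nth 0%R z i) = z.
Proof. by apply: eq_from_tnth => i; rewrite tnth_mktuple (tnth_nth 0%R). Qed.

Lemma product_section_le d1 d2 (T1 : measurableType d1) (T2 : measurableType d2)
    (m1 : {sigma_finite_measure set T1 -> \bar R})
    (m2 : {sigma_finite_measure set T2 -> \bar R})
    (A : set (T1 * T2)) (D : set T1) (U : R) :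
  measurable A -> measurable D -> (0 <= U)%R ->
  (forall t y, A (t, y) -> D t) ->
  (forall t, m2 (xsection A t) <= U%:E) ->
  (m1 \x m2) A <= U%:E * m1 D.
Proof.
move=> mA mD U0 AD AU; rewrite /product_measure1.
have E : m2 \o xsection A = (m2 \o xsection A) \_ D.
  apply/funext => t; rewrite /patch; case: ifPn => // tD.
  rewrite /= (_ : xsection A t = set0) ?measure0//.
  rewrite -subset0 => y; rewrite /xsection/= inE => /AD.
  by move: tD; rewrite notin_setE.
rewrite E -integral_mkcond -integral_cst//; apply: ge0_le_integral => //.
  exact: (measurable_funS measurableT (@subsetT _ _) (measurable_fun_xsection m2 mA)).
by move=> t _; exact: AU.
Qed.

Local Close Scope ereal_scope.

Definition tuple_convex n (K : set (n.-tuple RL)) :=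
  forall x y (s : R), 0 <= s <= 1 -> K (tup n x) -> K (tup n y) ->
  K (tup n (fun i => (1 - s) * x i + s * y i)).

Lemma measurable_tuple_box n :
  measurable [set t : n.-tuple RL | forall i, 0 <= tnth t i <= 1].
Proof.
rewrite (_ : [set t | _] = \bigcap_(i in [set: 'I_n])
    ((fun t : n.-tuple RL => tnth t i) @^-1` `[0, 1])).
  apply: fin_bigcap_measurable; first exact: finite_finset.
  move=> i _; rewrite -[X in measurable X]setTI.
  exact: (measurable_tnth (T := RL) i measurableT (measurable_itv _)).
by apply/seteqP; split => t /= H i; [move=> _|]; have := H i; rewrite /= in_itv/=; [|exact].
Qed.

Lemma lebesgue_tuple_le1 n (K : set (n.-tuple RL)) : measurable K ->
  (forall t, K t -> forall i, 0 <= tnth t i <= 1) -> (lebesgue_tuple n K <= 1)%E.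
Proof.
move=> mK K1; have := @lebesgue_tuple_box R n (fun=> 0) (fun=> 1) (fun=> ler01).
rewrite big1 => [<-|i _]; last by rewrite subr0.
by apply: le_measure; rewrite ?inE//; exact: measurable_tuple_box.
Qed.

(** The new box has first side [|a| / 2 >= D / 6], over a halved box in a section of volume at least
    [V / (2 D)]; the width [D] cancels, which gives the denominator [12 * 2^n]. New slopes are at
    most [3 / D <= 3 / V], old ones at most [2 b D / V <= 2 b / V]. *)
Lemma sheared_box_in_convex n : exists kb : R * R, [/\ 0 < kb.1, 0 <= kb.2 &
  forall (K : set (n.-tuple RL)) (V : R), measurable K -> tuple_convex K ->
   (forall t, K t -> forall i, 0 <= tnth t i <= 1) -> 0 < V ->
   (V%:E <= lebesgue_tuple n K)%E ->
   exists o l W, [/\ forall x, sheared_box n l W x -> K (tup n (fun i => o i + x i)),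
     forall i, (i < n)%N -> 0 < l i <= 1,
     forall i j, ((i + j).+1 < n)%N -> `|W i j| <= kb.2 / V &
     kb.1 * V <= \prod_(i < n) l i]].
Proof.
elim: n => [|n [[ka b] /= [ka0 b0 IH]]].
  exists (1, 0); split=> //= K V mK cK K1 V0 VK.
  have V1 : V <= 1 by rewrite -lee_fin (le_trans VK)// (lebesgue_tuple_le1 mK K1).
  exists 0, 0, 0; split=> // [x _|]; last by rewrite big_ord0 mul1r.
  move: VK => /=; rewrite diracE; have [|_] := boolP (_ \in K).
    by rewrite inE => K0 _; rewrite (_ : tup _ _ = [tuple])//; exact: tuple0.
  by rewrite lee_fin leNgt V0.
exists (ka / (12 * 2 ^+ n), 3 + 2 * b); split=> /=; [|lra|].
  by rewrite divr_gt0// mulr_gt0// exprn_gt0.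
move=> K V mK cK K1 V0 VK.
pose A := @tcons R n @^-1` K.
have mA : measurable A.
  by rewrite -[X in measurable X]setTI; exact: measurable_tcons.
have {}VK : (V%:E <= (@lebesgue_measure R \x lebesgue_tuple n) A)%E by [].
have K0 : K !=set0.
  apply/set0P/eqP => K0; move: VK; rewrite /A K0 preimage_set0 measure0.
  by rewrite lee_fin leNgt V0.
pose S := [set tnth t ord0 | t in K].
have S0 : S !=set0 by case: K0 => t Kt; exists (tnth t ord0); exists t.
have ubS : ubound S 1 by move=> _ [t Kt <-]; have /andP[] := K1 _ Kt ord0.
have lbS : lbound S 0 by move=> _ [t Kt <-]; have /andP[] := K1 _ Kt ord0.
have supS : has_sup S by split=> //; exists 1.
have infS : has_inf S by split=> //; exists 0.
pose p := inf S; pose r := sup S; pose D := r - p.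
have pSr u : S u -> p <= u <= r.
  by move=> Su; rewrite (ge_inf _ Su) ?(ub_le_sup _ Su)//; [exists 1|exists 0].
have AS t y : A (t, y) -> p <= t <= r.
  by move=> Aty; apply: pSr; exists (tcons (t, y)).
have D1 : D <= 1.
  have : r <= 1 by apply: ge_sup.
  have : 0 <= p by apply: lb_le_inf.
  rewrite /D; lra.
have D0 : 0 <= D.
  by case: S0 => u /pSr /andP[pu ur]; rewrite subr_ge0 (le_trans pu).
have AI t y : A (t, y) -> `[p, r]%classic t by move=> /AS; rewrite /= in_itv.
have secle U : 0 <= U -> (forall t, (lebesgue_tuple n (xsection A t) <= U%:E)%E) -> V <= U * D.
  move=> U0 AU; have := product_section_le (@lebesgue_measure R) mA (measurable_itv `[p, r]) U0 AI AU.
  move=> /(le_trans VK); rewrite [X in (_ * X)%E](lebesgue_measure_itv `[p, r]) /= lte_fin.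
  case: ifPn => _; first by rewrite -EFinB -EFinM lee_fin.
  by rewrite mule0 lee_fin leNgt V0.
have msec t : measurable (xsection A t) by exact: measurable_xsection.
have sec1 t y : xsection A t y -> forall i, 0 <= tnth y i <= 1.
  rewrite /xsection /= inE => Aty i; have := K1 _ Aty (lift ord0 i).
  by rewrite tnthS.
have VD : V <= D.
  by rewrite -[D]mul1r; apply: secle => // t; exact: lebesgue_tuple_le1 (sec1 t).
have Dpos : 0 < D by exact: lt_le_trans VD.
(* If all sections were smaller than [V / (2 D)], integrating over an interval of length [D] would
   give volume at most [V / 2]. *)
pose V' := V / (2 * D).
have V'0 : 0 < V' by rewrite divr_gt0// mulr_gt0.
have [t Vt] : exists t, (V'%:E <= lebesgue_tuple n (xsection A t))%E.
  apply: contrapT => H; have : V <= V' * D.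
    apply: secle; first exact: ltW.
    by move=> t; apply: ltW; rewrite ltNge; apply/negP => ?; apply: H; exists t.
  by rewrite (_ : V' * D = V / 2); [lra|rewrite /V'; field; rewrite gt_eqF].
have csec : tuple_convex (xsection A t).
  move=> x y s s01; rewrite /xsection /= !inE /A /= => Kx Ky.
  have := cK (scons t x) (scons t y) s s01; rewrite !tupS => /(_ Kx Ky) /=.
  by rewrite -mulrDl subrK mul1r.
case: (IH _ _ (msec t) csec (sec1 t) V'0 Vt) => o [l [W [shK l01 WB lV]]].
have Ao : K (tup n.+1 (scons t o)).
  rewrite tupS; have := shK 0 (sheared0 _ _); rewrite /xsection/= inE.
  rewrite (_ : (fun i => _) = o); last by apply/funext => i; rewrite addr0.
  by apply=> i ni; have /andP[/ltW] := l01 i ni.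
(* Points within [D / 6] of the two ends of the projection are more than [2 D / 3] apart, so one of
   them is at distance at least [D / 3] from [t]. The ends need not be attained, as [K] is not
   assumed closed. *)
have [z Kz zt] : exists2 z, K (tup n.+1 z) & D / 3 <= `|z 0%N - t|.
  have [u1 Su1 z1r] := @sup_adherent _ S (D / 6) (divr_gt0 Dpos (ltr0Sn _ _)) supS.
  have [u2 Su2 z2p] := @inf_adherent _ S (D / 6) (divr_gt0 Dpos (ltr0Sn _ _)) infS.
  case: Su1 z1r => z1 Kz1 <- z1r; case: Su2 z2p => z2 Kz2 <- z2p.
  have [h1|h1] := leP (D / 3) `|tnth z1 ord0 - t|.
    by exists (fun i => nth 0 z1 i); rewrite ?tup_nth// -(tnth_nth 0 z1 ord0).
  exists (fun i => nth 0 z2 i); rewrite ?tup_nth// -(tnth_nth 0 z2 ord0).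
  rewrite leNgt; apply/negP => h2; move: h1 h2 z1r z2p.
  rewrite -/p -/r !ltr_norml /D => /andP[? ?] /andP[? ?] ? ?; lra.
pose a := z 0%N - t.
have a0 : a != 0.
  by apply/eqP => a0; move: zt; rewrite -/a a0 normr0 leNgt divr_gt0.
have inK x i : (i < n.+1)%N -> K (tup n.+1 x) -> 0 <= x i <= 1.
  by move=> ni /K1 /(_ (Ordinal ni)); rewrite tnth_mktuple.
have t01 : 0 <= t <= 1 := inK _ 0%N isT Ao.
have z01 : 0 <= z 0%N <= 1 := inK _ 0%N isT Kz.
have a1 : `|a| <= 1 by rewrite ler_norml /a; lra.
(* The box lies in the cone of points [(1 - s) u + s z] with [u] in the box of
   the section and [0 <= s <= 1/2]; [s0] is the value of [s] at the origin of
   the new box, which is its left end since [0 <= x 0]. *)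
pose s0 : R := if 0 < a then 0 else 1 / 2.
exists (scons (t + s0 * a) (fun i => o i + s0 * (z i.+1 - o i))),
  (scons (`|a| / 2) (fun i => l i / 2)),
  (scons (fun i => (z i.+1 - o i) / a) W).
split.
- move=> x [/= /andP[x0 xa] sx].
  pose s := s0 + x 0%N / a.
  have s01 : 0 <= s <= 1 / 2.
    rewrite /s /s0; move: xa; have [ap|an] := ltP 0 a.
      rewrite gtr0_norm// => xa; rewrite add0r divr_ge0 ?(ltW ap)//=.
      by rewrite ler_pdivrMr//; lra.
    have {}an : a < 0 by rewrite lt_neqAle a0.
    rewrite ltr0_norm// => xa.
    have h1 : x 0%N / a <= 0 by rewrite mulr_ge0_le0// invr_le0 ltW.
    have h2 : - (1 / 2) <= x 0%N / a by rewrite -(ler_nM2r an) divfK//; lra.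
    by lra.
  have s1 : 0 < 1 - s by lra.
  (* This undoes the contraction by [1 - s] in the cone; as [1 - s >= 1/2], halved sides suffice. *)
  pose u i := (tail x i - x 0%N * ((z i.+1 - o i) / a)) / (1 - s).
  have su : sheared_box n l W u.
    apply: (@sheared_scale _ _ _ _ _ (1 / 2)) => //; first by lra.
      by move=> i ni; have /andP[/ltW] := l01 i ni.
    by rewrite (_ : (fun i => _) = tail (scons (`|a| / 2) (fun i => l i / 2)))//;
       apply/funext => i; rewrite /tail /= mulrC mul1r.
  have := shK _ su; rewrite /xsection /= inE => Ku.
  have s01' : 0 <= s <= 1 by lra.
  have := cK (scons t (fun i => o i + u i)) z s s01'; rewrite tupS => /(_ Ku Kz).
  congr (K (tup _ _)); apply/funext => -[|i] /=.
    rewrite (_ : z 0%N = t + a) /s; last by rewrite /a addrC subrK.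
    by field.
  rewrite /u /tail; move/lt0r_neq0: s1 => s1; rewrite mulrDr mulrCA divff// mulr1 /s; field => //.
- move=> [|i] ni /=; first by rewrite divr_gt0 ?normr_gt0//=; lra.
  have := l01 i ni; lra.
- move=> [|i] j ij /=.
    rewrite normrM normfV ler_pdivrMr ?normr_gt0//.
    have := inK _ j.+1 ij Ao; have := inK _ j.+1 ij Kz => /= zj oj.
    apply: (@le_trans _ _ 1); first by rewrite ler_norml; lra.
    rewrite mulrAC ler_pdivlMr// mul1r.
    have : 0 <= 2 * b * `|a| by rewrite mulr_ge0// mulr_ge0.
    rewrite -/a in zt; lra.
  apply: le_trans (WB i j ij) _.
  rewrite (_ : b / V' = b * (2 * D) / V); last by rewrite /V'; field; rewrite !gt_eqF.
  rewrite ler_pM2r ?invr_gt0//.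
  have : b * (2 * D) <= b * 2 by rewrite ler_wpM2l//; lra.
  lra.
- rewrite big_ord_recl /= big_split /= prodr_const card_ord.
  apply: (@le_trans _ _ (D / 6 * (ka * V' * 2^-1 ^+ n))).
    rewrite le_eqVlt; apply/orP; left; apply/eqP.
    by rewrite /V' exprVn; field; rewrite ?gt_eqF// exprn_gt0.
  apply: ler_pM.
  + by rewrite divr_ge0.
  + by rewrite mulr_ge0 ?exprn_ge0// mulr_ge0 ?ltW.
  + rewrite -/a in zt; lra.
  + by rewrite ler_wpM2r// exprn_ge0.
Qed.

End sheared_box_in_convex.

(** * Expectation of products along a lacunary sequence *)

Section expectation.
Context {R : realType} {d : nat}.
Variable mu : probability (borelRV R d) R.
Local Notation RL := (measurableTypeR R).

Definition coords (x : 'rV[R]_d) : nat -> R :=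
  fun i => if insub i is Some j then x ord0 j else 0.

Lemma coords_ord x (i : 'I_d) : coords x i = x ord0 i.
Proof. by rewrite /coords valK. Qed.

Lemma continuous_measurable (f : 'rV[R]_d -> R) : continuous f ->
  measurable_fun setT (f : borelRV R d -> R).
Proof.
move=> /continuousP cf.
apply: (measurability _ (measurable_realfun.RGenOpens.measurableE R)) => _ [_ [a [b ->]] <-].
rewrite setTI; apply: sub_sigma_algebra; apply: cf; exact: interval_open.
Qed.

Lemma measurable_closed (A : set 'rV[R]_d) : closed A -> measurable (A : set (borelRV R d)).
Proof.
move=> cA; rewrite -[A]setCK; apply: measurableC.
by apply: sub_sigma_algebra; exact: closed_openC.
Qed.

Lemma closed_cube : closed (@cube R d).
Proof.
rewrite (_ : @cube R d = \bigcap_(i in [set: 'I_d]) ((fun x : 'rV[R]_d => x ord0 i) @^-1` `[0, 1])).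
  apply: closed_bigI => i _; apply: preimage_closed; last exact: interval_closed.
  by move=> x _; exact: coord_continuous.
by apply/seteqP; split => x /= H i; [move=> _|]; have := H i; rewrite /= in_itv/=; [|exact].
Qed.

Lemma measurable_cube : measurable (@cube R d : set (borelRV R d)).
Proof. by apply: measurable_closed; exact: closed_cube. Qed.

Lemma continuous_coords i : continuous (fun x : 'rV[R]_d => coords x i).
Proof.
rewrite /coords; case: insubP => [j _ _|_]; last exact: cst_continuous.
exact: coord_continuous.
Qed.

Lemma continuous_inner n k : continuous (fun x : 'rV[R]_d => inner n k (coords x)).
Proof.
elim: n => [|n IH].
  rewrite (_ : (fun x => _) = cst 0); first exact: cst_continuous.
  by apply/funext => x; rewrite /inner big_ord0.
rewrite (_ : (fun x => _) = (fun x => inner n k (coords x)) \+ (cst (k n) \* (fun x => coords x n))).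
  move=> x; apply: continuousD; first exact: IH.
  by apply: continuousM; [exact: cst_continuous|exact: continuous_coords].
by apply/funext => x; rewrite /inner big_ord_recr.
Qed.

Lemma tp_continuous Q H f : tp d Q H f -> continuous (fun x : 'rV[R]_d => f (coords x)).
Proof.
elim=> {H f}.
- move=> k p _ x; apply: (@continuous_comp _ _ _
    ((cst (2 * pi) \* (fun x => inner d k (coords x))) \+ cst p) (@cos R)).
    apply: continuousD; last exact: cst_continuous.
    by apply: continuousM; [exact: cst_continuous|exact: continuous_inner].
  exact: continuous_cos.
- exact: cst_continuous.
- move=> a b H H' f g _ cf _ cg x.
  apply: (@continuousD _ _ _ (cst a \* (fun x => f (coords x)))
    (cst b \* (fun x => g (coords x)))); apply: continuousM.
  + exact: cst_continuous.
  + exact: cf.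
  + exact: cst_continuous.
  + exact: cg.
- by [].
Qed.

Definition expect (f : (nat -> R) -> R) : R :=
  (\int[mu]_(x in @cube R d) f (coords x))%R.

Lemma tp_integrable Q H f : tp d Q H f ->
  mu.-integrable (@cube R d) (EFin \o (fun x => f (coords x))).
Proof.
move=> Hf; apply: measurable_bounded_integrable => //.
- exact: measurable_cube.
- by rewrite (le_lt_trans (probability_le1 mu measurable_cube))// ltry.
- by apply: measurable_funTS; apply: continuous_measurable; exact: tp_continuous Hf.
- exists H; split; first exact: num_real.
  by move=> M HM x _ /=; rewrite (le_trans (tp_norm _ Hf))// ltW.
Qed.

Lemma expect_lin a b Q Q' H H' f g : tp d Q H f -> tp d Q' H' g ->
  expect (fun x => a * f x + b * g x) = a * expect f + b * expect g.
Proof.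
move=> Hf Hg; rewrite /expect.
rewrite (RintegralD measurable_cube (tp_integrable (tp_scale a Hf))
  (tp_integrable (tp_scale b Hg))).
by rewrite !RintegralZl//; do ?[exact: measurable_cube];
  [exact: tp_integrable Hg|exact: tp_integrable Hf].
Qed.

Lemma expect_cst c : mu (@cube R d) = 1%E -> expect (fun=> c) = c.
Proof.
by move=> mu1; rewrite /expect (Rintegral_cst mu measurable_cube) [fine _](congr1 fine mu1) mulr1.
Qed.

Lemma expect_tp (Q : (nat -> R) -> Prop) H f (delta : R) :
  (forall k p, Q k -> `|expect (fun x => cos (2 * pi * inner d k x + p))| <= delta) ->
  0 <= delta ->
  tp d Q H f -> `|expect f| <= H * delta.
Proof.
move=> Qd d0; elim=> {H f}.
- by move=> k p /Qd; rewrite mul1r.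
- by rewrite /expect (Rintegral_cst mu measurable_cube) !mul0r normr0.
- move=> a b H H' f g Hf IH Hg IH'; rewrite (expect_lin _ _ Hf Hg).
  by rewrite (le_trans (ler_normD _ _))// !normrM mulrDl -!mulrA lerD// ler_wpM2l.
- by move=> H H' f HH' _ IH; rewrite (le_trans IH)// ler_wpM2r.
Qed.

Lemma expect_cos_fourier k p :
  `|expect (fun x => cos (2 * pi * inner d k x + p))| <=
  2 * Normc.normc (fourier mu (\row_i k i)).
Proof.
have tpk c : tp d setT 1 (fun x => cos (2 * pi * inner d k x + c)) by exact: tp_cos.
have E (x : 'rV[R]_d) : dot (\row_i k i) x = inner d k (coords x).
  by rewrite /dot /inner; apply: eq_bigr => i _; rewrite mxE coords_ord.
have -> : expect (fun x => cos (2 * pi * inner d k x + p)) =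
    cos p * complex.Re (fourier mu (\row_i k i)) - sin p * complex.Im (fourier mu (\row_i k i)).
  rewrite /fourier /Cintegral /expi /=; under [X in _ * X - _]eq_Rintegral do rewrite E.
  under [X in _ - _ * X]eq_Rintegral do rewrite E.
  have := expect_lin (cos p) (- sin p) (tpk 0) (tpk (- (pi / 2))).
  rewrite /expect mulNr => h.
  transitivity (cos p * \int[mu]_(x in @cube R d) cos (2 * pi * inner d k (coords x) + 0) -
     sin p * \int[mu]_(x in @cube R d) cos (2 * pi * inner d k (coords x) - pi / 2)).
    rewrite -h; apply: eq_Rintegral => x _.
    by rewrite cosD addr0 cosBpihalf; ring.
  by congr (_ * _ - _ * _); apply: eq_Rintegral => x _; rewrite ?addr0 ?cosBpihalf.
case: (fourier mu _) => u w /=.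
have uw : `|u| <= Num.sqrt (u ^+ 2 + w ^+ 2) /\ `|w| <= Num.sqrt (u ^+ 2 + w ^+ 2).
  by rewrite -!sqrtr_sqr; split; rewrite ler_wsqrtr// ?lerDl ?lerDr sqr_ge0.
rewrite mulr2n mulrDl mul1r (le_trans (ler_normB _ _))// !normrM lerD//.
  by rewrite -[leRHS]mul1r ler_pM ?cos_max// uw.1.
by rewrite -[leRHS]mul1r ler_pM ?sin_max// uw.2.
Qed.

Definition bounded_freq (D : R) (k : nat -> R) := forall i, (i < d)%N -> `|k i| <= D.

Definition large_freq (D : R) (k : nat -> R) := exists2 i, (i < d)%N & D <= `|k i|.

Section product.
Variables (G : nat -> (nat -> R) -> R) (v H : R) (m : nat) (a delta : nat -> R).
Hypothesis mu1 : mu (@cube R d) = 1%E.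
Hypothesis v01 : 0 <= v <= 1.
Hypothesis m1 : (1 <= m)%N.
Hypothesis a_ge0 : forall j, 0 <= a j.
Hypothesis aS : forall j, (4 * m%:R) * a j <= a j.+1.
Hypothesis G_tp : forall j,
  tp d (fun k => bounded_freq (m%:R * a j) k /\ large_freq (a j) k) H (fun x => G j x - v).
Hypothesis delta_ge0 : forall j, 0 <= delta j.
Hypothesis expect_large : forall j k p, large_freq (a j / 2) k ->
  `|expect (fun x => cos (2 * pi * inner d k x + p))| <= delta j.

(** A new factor adds frequencies up to [m a_J] to those, at most [a_J / 2], already present. The
    sum is at most [2 m a_J <= a_(J+1) / 2], which explains the growth factor [4 m]. *)
Lemma prod_tp J : tp d (bounded_freq (a J / 2)) ((1 + H) ^+ J)
  (fun x => \prod_(j < J) (1 - G j x)).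
Proof.
have mR : 1 <= m%:R :> R by rewrite ler1n.
elim: J => [|J IH].
  have /(_ _)/tp_ext := @tp_cst R d (bounded_freq (a 0%N / 2)) 1; rewrite normr1.
  apply=> [x|i _]; first by rewrite big_ord0.
  by rewrite normr0 divr_ge0.
have H0 := tp_ge0 (G_tp 0).
have /andP[v0 v1] := v01.
have h : tp d (bounded_freq (m%:R * a J)) (1 + H) (fun x => 1 - G J x).
  have b0 : bounded_freq (m%:R * a J) 0 by move=> i _; rewrite normr0 mulr_ge0.
  have h1 := tp_sub (fun k (hk : _ /\ _) => hk.1) (G_tp J).
  have := tp_lin 1 (-1) (tp_cst d (1 - v) b0) h1.
  rewrite normrN normr1 !mul1r => h2.
  apply: tp_le (tp_ext _ h2) => [|x]; last by ring.
  by rewrite lerD2r ger0_norm; lra.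
rewrite exprSr; apply: tp_ext (tp_mul _ IH h) => [x|k k' bk bk'].
  by rewrite big_ord_recr.
have le i : (i < d)%N -> `|k i| + `|k' i| <= a J.+1 / 2.
  move=> id; have := bk i id; have := bk' i id; have := aS J; have := a_ge0 J.
  nra.
by split=> i id; [apply: le_trans (ler_normD _ _) (le i id)|
  apply: le_trans (ler_normB _ _) (le i id)].
Qed.

(** With [P] the product of the first [J] factors, the next product is [(1 - v) P - P (G_J - v)].
    Frequencies of [G_J - v] reach [a_J] in some coordinate, where those of [P] are at most
    [a_J / 2]; so every frequency of [P (G_J - v)] has size at least [a_J / 2], and decay
    applies. *)
Lemma expect_prod J : expect (fun x => \prod_(j < J) (1 - G j x)) <=
  (1 - v) ^+ J + \sum_(j < J) (1 + H) ^+ j.+1 * delta j.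
Proof.
have mR : 1 <= m%:R :> R by rewrite ler1n.
have H0 := tp_ge0 (G_tp 0).
have /andP[v0 v1] := v01.
elim: J => [|J IH].
  rewrite big_ord0 addr0 expr0.
  by under [X in expect X]eq_fun do rewrite big_ord0; rewrite expect_cst.
set P := (fun x => _) in IH.
have hP := prod_tp J; rewrite -/P in hP.
have hPh : tp d (large_freq (a J / 2)) ((1 + H) ^+ J * H) (fun x => P x * (G J x - v)).
  apply: tp_mul hP (G_tp J) => k k' bk [bk' [i id ak']].
  have ki := bk i id.
  split; exists i => //.
  - have := ler_normB (k i + k' i) (k i); rewrite addrAC subrr add0r => h.
    by change (a J / 2 <= `|k i + k' i|); lra.
  - have := ler_normB (k i) (k i - k' i); rewrite opprB addrC subrK => h.
    by change (a J / 2 <= `|k i - k' i|); lra.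
have -> : expect (fun x => \prod_(j < J.+1) (1 - G j x)) =
    (1 - v) * expect P + (-1) * expect (fun x => P x * (G J x - v)).
  rewrite -(expect_lin _ _ hP hPh); congr expect; apply/funext => x.
  by rewrite big_ord_recr /=; rewrite /P; ring.
have := expect_tp (expect_large (j := J)) (delta_ge0 J) hPh.
rewrite big_ord_recr /= exprS.
have : (1 - v) * expect P <= (1 - v) * (1 - v) ^+ J + \sum_(j < J) (1 + H) ^+ j.+1 * delta j.
  apply: le_trans (ler_wpM2l _ IH) _; first lra.
  rewrite mulrDr lerD2l ler_piMl//; last lra.
  by apply: sumr_ge0 => j _; rewrite mulr_ge0// exprn_ge0// addr_ge0.
have : (1 + H) ^+ J * H * delta J <= (1 + H) ^+ J.+1 * delta J.
  rewrite ler_wpM2r// exprSr ler_wpM2l ?exprn_ge0 ?addr_ge0//; lra.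
move=> h1 h2; rewrite ler_norml => /andP[h3 _]; lra.
Qed.

End product.

Lemma coord_le_norm (x : 'rV[R]_d) i : `|x ord0 i| <= `|x|.
Proof. by rewrite [leRHS]/Num.norm /= mx_normrE; apply: (le_bigmax_cond _ _ (j := (ord0, i))). Qed.

(** Equivalence of norms: [nrm] is Lipschitz for the sup norm, hence has a positive minimum on the
    compact unit sphere of the latter. *)
Lemma norm_lower_bound (nrm : 'rV[R]_d -> R) : is_norm nrm ->
  exists2 c : R, 0 < c & forall k D, 0 <= D -> large_freq D k -> c * D <= nrm (\row_i k i).
Proof.
move=> [nD nZ n0].
have nN x : nrm (- x) = nrm x by rewrite -scaleN1r nZ normrN normr1 mul1r.
have nrm0 : nrm 0 = 0 by rewrite -(scale0r (0 : 'rV[R]_d)) nZ normr0 mul0r.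
have nge0 x : 0 <= nrm x.
  by have := nD x (- x); rewrite subrr nrm0 nN; lra.
pose M := \sum_(j < d) nrm (delta_mx ord0 j).
have M0 : 0 <= M by exact: sumr_ge0.
have nsum (I : Type) (s : seq I) (f : I -> 'rV[R]_d) :
    nrm (\sum_(j <- s) f j) <= \sum_(j <- s) nrm (f j).
  elim: s => [|j s IH]; first by rewrite !big_nil nrm0.
  by rewrite !big_cons (le_trans (nD _ _))// lerD2l.
have nle x : nrm x <= `|x| * M.
  rewrite {1}[x]row_sum_delta (le_trans (nsum _ _ _))// mulr_sumr.
  by apply: ler_sum => j _; rewrite nZ ler_wpM2r// coord_le_norm.
have M1 : 0 < M + 1 by lra.
have ncont : continuous nrm.
  move=> x; apply/(@cvgrPdist_le R R^o _ (nbhs x) (nbhs_filter x)) => e e0; near=> y.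
  have h : `|nrm x - nrm y| <= nrm (x - y).
    have := nD y (x - y); have := nD x (y - x); rewrite !subrKC -(nN (y - x)) opprB.
    by rewrite ler_norml; lra.
  apply: (le_trans h); apply: (le_trans (nle _)).
  apply: (@le_trans _ _ (`|x - y| * (M + 1))); first by rewrite ler_wpM2l// lerDl.
  rewrite -ler_pdivlMr//; near: y.
  apply/nbhs_ballP; exists (e / (M + 1)) => /=; first by rewrite divr_gt0.
  by move=> y'; rewrite mx_norm_ball /ball_ /= => /ltW.
have large_norm k D : large_freq D k -> D <= `|\row_(i < d) k i|.
  by move=> [i id /le_trans]; apply; have := coord_le_norm (\row_(i < d) k i) (Ordinal id); rewrite mxE.
pose S := [set x : 'rV[R]_d | `|x| = 1].
have normS x : x != 0 -> S (`|x|^-1 *: x).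
  move=> x0; rewrite /S /= normrZ ger0_norm ?invr_ge0//.
  by rewrite mulVf// normr_eq0.
have cS : compact S.
  apply: bounded_closed_compact.
    by exists 1; split; [exact: num_real|move=> y y1 x /= ->; exact: ltW].
  rewrite (_ : S = (fun x : 'rV[R]_d => `|x|) @^-1` [set 1]) //.
  apply: preimage_closed; last exact: closed_eq.
  by move=> x _; exact: norm_continuous.
have [S0|S0] := pselect (S !=set0); last first.
  exists 1 => // k D D0 /large_norm kD.
  have k0 : \row_(i < d) k i = 0.
    by apply/eqP/negPn/negP => /normS h; apply: S0; eexists; exact: h.
  by move: kD; rewrite k0 normr0 mul1r nrm0.
have [c cS' cmin] := compact_EVT_min S0 cS (continuous_subspaceT ncont).
have c0 : 0 < nrm c.
  rewrite lt0r nge0 andbT; apply/eqP => /n0 c0; move: cS'.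
  by rewrite inE /S /= c0 normr0 => /eqP; rewrite eq_sym oner_eq0.
exists (nrm c) => // k D D0 /large_norm kD.
set x := \row_(i < d) k i in kD *.
have [x0|x0] := eqVneq x 0.
  have -> : D = 0 by apply/eqP; rewrite eq_le D0 andbT (le_trans kD)// x0 normr0.
  by rewrite mulr0.
have := cmin (`|x|^-1 *: x); rewrite inE => /(_ (normS _ x0)).
rewrite nZ ger0_norm ?invr_ge0// mulrC ler_pdivlMr ?normr_gt0// => h.
by apply: le_trans h; rewrite ler_wpM2l// ltW.
Unshelve. all: by end_near. Qed.

End expectation.

(** * A polynomial family of discretised sheared_box boxes *)

Section covering.
Context {R : realType} {d : nat}.
Local Notation RL := (measurableTypeR R).

Definition row_of_tuple (t : d.-tuple RL) : 'rV[R]_d := \row_i tnth t i.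

Lemma row_of_tup (x : nat -> R) : row_of_tuple (tup d x) = \row_i x i.
Proof. by apply/rowP => i; rewrite !mxE tnth_mktuple. Qed.

(** [U] is the union of the countably many open cubes with rational centre and radius [1/(k+1)] that
    it contains, and these are measurable for the product sigma-algebra. *)
Lemma measurable_open_tuple (U : set 'rV[R]_d) : open U ->
  measurable [set t | U (row_of_tuple t)].
Proof.
move=> oU.
pose box (c : 'rV[rat]_d * nat) (x : 'I_d -> R) :=
  forall i, ratr (c.1 ord0 i) - c.2.+1%:R^-1 < x i < ratr (c.1 ord0 i) + c.2.+1%:R^-1.
pose B c : set (d.-tuple RL) :=
  [set t | box c (tnth t) /\ (forall y : 'rV[R]_d, box c (y ord0) -> U y)].
rewrite (_ : [set t | _] = \bigcup_c B c).
  apply: countable_bigcupT_measurable => [|c]; first exact: countableP.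
  have [cU|cU] := pselect (forall y : 'rV[R]_d, box c (y ord0) -> U y); last first.
    rewrite (_ : B c = set0); first exact: measurable0.
    by apply/seteqP; split => // t [].
  rewrite (_ : B c = \bigcap_(i in [set: 'I_d]) ((fun t : d.-tuple RL => tnth t i) @^-1`
     `]ratr (c.1 ord0 i) - c.2.+1%:R^-1, ratr (c.1 ord0 i) + c.2.+1%:R^-1[)).
    apply: fin_bigcap_measurable; first exact: finite_finset.
    move=> i _; rewrite -[X in measurable X]setTI.
    exact: (measurable_tnth (T := RL) i measurableT (measurable_itv _)).
  apply/seteqP; split => t /=.
    by move=> [bt _] i _ /=; rewrite in_itv/=; exact: bt.
  move=> H; split=> // i; by have := H i Logic.I; rewrite /= in_itv.
apply/seteqP; split => [t /= Ut|t [c _ [bt cU]]]; last first.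
  by apply: cU => i; rewrite mxE.
have [e /= e0 eU] : exists2 e : R, 0 < e & forall y, ball (row_of_tuple t) e y -> U y.
  by have /nbhs_ballP[e /= e0 eU] := open_nbhs_nbhs (conj oU Ut); exists e.
have [k ke] : exists k : nat, 2 * k.+1%:R^-1 < e.
  exists (Num.trunc (2 / e)); have := truncnS_gt (2 / e).
  by rewrite ltr_pdivrMr// mulrC => h; rewrite -ltr_pdivlMr ?invr_gt0// invrK.
have k0 : 0 < k.+1%:R^-1 :> R by rewrite invr_gt0.
have qx i : exists q : rat, tnth t i - k.+1%:R^-1 < ratr q < tnth t i + k.+1%:R^-1.
  have h : tnth t i - k.+1%:R^-1 < tnth t i + k.+1%:R^-1.
    by rewrite ltrD2l (lt_trans _ k0)// oppr_lt0.
  have [q] := rat_in_itvoo h.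
  by rewrite in_itv; exists q.
have [q qP] := choice qx.
exists (\row_i q i, k) => //; split=> [i|y yP] /=.
  by rewrite !mxE; have /andP[h1 h2] := qP i; rewrite ltrBlDr h2 -ltrBlDr h1.
apply: eU; split=> // i j; rewrite ord1 /ball /= mxE.
have := yP j; have := qP j; rewrite /= mxE.
move: (tnth t j : R) (ratr _) (_^-1) ke => x r u ke; rewrite ltr_norml; lra.
Qed.

Lemma measurable_closed_tuple (K : set 'rV[R]_d) : closed K ->
  measurable [set t | K (row_of_tuple t)].
Proof.
move=> cK; rewrite -[X in measurable X]setCK; apply: measurableC.
exact: (measurable_open_tuple (closed_openC cK)).
Qed.

Lemma convex_body_tuple (K : set 'rV[R]_d) : convex_body K ->
  tuple_convex [set t | K (row_of_tuple t)].
Proof.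
move=> [_ cK] x y s /andP[s0 s1]; rewrite /= !row_of_tup => Kx Ky.
have := cK (\row_i y i) (\row_i x i) (Itv01 s0 s1); rewrite !inE => /(_ Ky Kx).
by congr (K _); apply/rowP => i; rewrite !mxE /= addrC.
Qed.

(* A box is encoded by integers below Q: its origin in units of rho, its side
   lengths in units of 1/(m+1), and its slopes, shifted by B to be nonnegative,
   in units of rho. *)
Definition param Q := {ffun 'I_d + 'I_d + 'I_d * 'I_d -> 'I_Q}.

Definition param_origin Q (rho : R) (p : param Q) (i : nat) : R :=
  if insub i is Some i' then rho * (p (inl (inl i')))%:R else 0.

Definition param_length Q (p : param Q) (i : nat) : nat :=
  if insub i is Some i' then p (inl (inr i')) else 0%N.

Definition param_slope Q (rho B : R) (p : param Q) (i j : nat) : R :=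
  if (insub i, insub j) is (Some i', Some j') then
    rho * (p (inr (i', j')))%:R - B else 0.

Lemma round_nat (rho x : R) : 0 < rho -> 0 <= x ->
  exists2 k : nat, `|x - rho * k%:R| <= rho & k%:R <= x / rho.
Proof.
move=> rho0 x0; exists (Num.trunc (x / rho)).
  have /andP[h1 h2] := truncn_itv (divr_ge0 x0 (ltW rho0)).
  move: h1 h2; rewrite ler_pdivlMr// ltr_pdivrMr// -natr1 => h1 h2.
  by rewrite ler_norml; apply/andP; split; lra.
by have /andP[] := truncn_itv (divr_ge0 x0 (ltW rho0)).
Qed.

Lemma sheared_center_in n l W : (forall i, (i < n)%N -> 0 <= l i) ->
  @sheared_box R n l W (sheared_center n l W).
Proof.
elim: n l W => [//|n IH] l W l0 /=; split; first by have := l0 0%N isT; lra.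
rewrite (_ : (fun i => _) = sheared_center n (tail l) (tail W)).
  by apply: IH => i; exact: (l0 i.+1).
by apply/funext => i; rewrite /tail /=; ring.
Qed.

(** As no side exceeds 1, the lower bound on the volume of a box also bounds each of its sides from
    below. *)
Lemma prod_le_factor n (l : nat -> R) j : (j < n)%N ->
  (forall i, (i < n)%N -> 0 < l i <= 1) -> \prod_(i < n) l i <= l j.
Proof.
move=> jn l01; rewrite (bigD1 (Ordinal jn)) //= ler_piMr ?(ltW (proj1 (andP (l01 j jn))))//.
by apply: prodr_ile1 => i _; have /andP[/ltW -> ->] := l01 i (ltn_ord i).
Qed.

(** Role of the numerical hypotheses: errors [2 rho] (one [rho] from rounding the origin, one from
    [e]), amplified by the shear, fit in the margin [l i / 4]; the grid of step [1/(m+1)] keeps a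
    quarter of each side, whence [4^d]; all codes stay below [Q]. The free displacement [e] serves
    in [disc_hit]. *)
Lemma covering : exists kb : R * R, [/\ 0 < kb.1, 0 <= kb.2 &
  forall (K : set 'rV[R]_d) (V : R) (m Q : nat) (rho B : R),
  convex_body K -> K `<=` @cube R d -> 0 < V -> (V%:E <= Vol K)%E ->
  kb.2 / V <= B -> 0 < rho ->
  (2 * (1 + B)) ^+ d * (2 * rho) * 2 <= kb.1 * V / 4 ->
  4 <= m.+1%:R * (kb.1 * V) ->
  (m.+1 < Q)%N -> rho^-1 + 1 <= Q%:R -> 2 * B / rho + 1 <= Q%:R ->
  exists p : param Q, [/\ forall i, (i < d)%N -> (param_length p i <= m.+1)%N,
    kb.1 / 4 ^+ d * V <= \prod_(i < d) ((param_length p i)%:R / m.+1%:R) &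
    forall y e, near_disc m rho d (param_length p) (param_slope rho B p) y ->
      (forall i, (i < d)%N -> `|e i| <= rho) ->
      K (\row_i (param_origin rho p i + y i + e i))]].
Proof.
have [[ka b] [/= ka0 b0 shK]] := @sheared_box_in_convex R d.
exists (ka, b); split=> //= K V m Q rho B cK Kcube V0 VK bB rho0 Hrho Hm mQ Q1 Q2.
have cl : closed K by apply: (compact_closed _ cK.1); exact: norm_hausdorff.
case: (shK _ V (measurable_closed_tuple cl) (convex_body_tuple cK) _ V0 VK).
  move=> t /= /Kcube /[swap] i /(_ i); by rewrite mxE.
move=> o [l [W [shl l01 WB lV]]].
have B0 : 0 <= B by apply: le_trans bB; rewrite divr_ge0// ltW.
have l0 i : (i < d)%N -> 0 <= l i by move=> /l01 /andP[/ltW].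
have lkV i : (i < d)%N -> ka * V <= l i.
  by move=> id; apply: le_trans (prod_le_factor id l01).
set q : R := m.+1%:R; have q0 : 0 < q by rewrite ltr0n.
pose c := sheared_center d l W.
have c01 i : (i < d)%N -> 0 <= o i + c i <= 1.
  move=> id; have := shl _ (sheared_center_in W l0); rewrite /= row_of_tup.
  by move=> /Kcube /(_ (Ordinal id)); rewrite mxE.
have okP (i : 'I_d) : exists k : 'I_Q, `|o i + c i - rho * k%:R| <= rho.
  have /andP[c0 c1] := c01 i (ltn_ord i).
  have [k kr kle] := round_nat rho0 c0.
  suff kQ : (k < Q)%N by exists (Ordinal kQ).
  rewrite -(ltr_nat R); apply: le_lt_trans kle _; apply: lt_le_trans Q1.
  by apply: (@le_lt_trans _ _ rho^-1); rewrite ?ltrDl// ler_piMl// invr_ge0 ltW.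
have wkP (ij : 'I_d * 'I_d) : exists k : 'I_Q,
    ((ij.1 + ij.2).+1 < d)%N -> `|W ij.1 ij.2 + B - rho * k%:R| <= rho.
  have [ijd|] := boolP ((ij.1 + ij.2).+1 < d)%N; last first.
    by exists (Ordinal (leq_ltn_trans (leq0n _) mQ)).
  have Wij : `|W ij.1 ij.2| <= B by apply: le_trans bB; exact: WB.
  have w0 : 0 <= W ij.1 ij.2 + B by move: Wij; rewrite ler_norml => /andP[]; lra.
  have [k kr kle] := round_nat rho0 w0.
  suff kQ : (k < Q)%N by exists (Ordinal kQ).
  rewrite -(ltr_nat R); apply: le_lt_trans kle _; apply: lt_le_trans Q2.
  apply: (@le_lt_trans _ _ (2 * B / rho)); rewrite ?ltrDl//.
  by rewrite ler_pM2r ?invr_gt0//; move: Wij; rewrite ler_norml => /andP[]; lra.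
have LkP (i : 'I_d) : exists k : 'I_Q, [/\ (k <= m.+1)%N, k%:R / q <= l i / 2 & l i / 4 <= k%:R / q].
  have /andP[li0 li1] := l01 i (ltn_ord i).
  have x0 : 0 <= q * l i / 2 by rewrite divr_ge0// mulr_ge0// ltW.
  have /andP[h1 h2] := truncn_itv x0.
  set k := Num.trunc _ in h1 h2.
  have km : (k <= m.+1)%N.
    rewrite -(ler_nat R) -/q (le_trans h1)// ler_pdivrMr//.
    by rewrite ler_pM// ?(ltW q0) ?(ltW li0)//; lra.
  exists (Ordinal (leq_ltn_trans km mQ)); split=> //=.
    by rewrite ler_pdivrMr//; move: h1; lra.
  rewrite ler_pdivlMr//; have := lkV i (ltn_ord i) => h.
  have h4 : 4 <= q * l i by apply: le_trans Hm _; rewrite ler_pM2l.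
  move: h2 h4; rewrite -[k.+1%:R]natr1 (_ : l i / 4 * q = q * l i / 4); last by ring.
  by move: (q * l i) (k%:R : R) => u v; lra.
have [fo foP] := choice okP; have [fw fwP] := choice wkP; have [fL fLP] := choice LkP.
pose p : param Q := [ffun s => match s with
  | inl (inl i) => fo i | inl (inr i) => fL i | inr ij => fw ij end].
have pL (i : 'I_d) : param_length p i = fL i by rewrite /param_length valK ffunE.
have pL' i (id : (i < d)%N) : param_length p i = fL (Ordinal id) by exact: (pL (Ordinal id)).
exists p; split.
- move=> i id; rewrite pL'.
  by have [] := fLP (Ordinal id).
- apply: (@le_trans _ _ (\prod_(i < d) (l i / 4))).
    rewrite big_split /= prodr_const card_ord exprVn mulrAC.
    by apply: ler_wpM2r lV; rewrite invr_ge0 exprn_ge0.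
  apply: ler_prod => i _; rewrite divr_ge0 ?l0//= pL.
  by have [] := fLP i.
- move=> y e ny He.
  pose e' i := e i + (param_origin rho p i - (o i + c i)).
  have := @near_disc_sheared_box R m d l W (param_length p) (param_slope rho B p) B rho (2 * rho)
    y e' B0 _ _ _ _ _ ny.
  move=> h; have {}h := shl _ (h _ _ _ _ _).
  move: h; rewrite /= row_of_tup => h.
  rewrite (_ : \row_i _ = \row_i (o i + (sheared_center d l W i + y i + e' i))).
    apply: h.
    + by rewrite ltW//=; lra.
    + move=> i id; rewrite pL'.
      by have [h1 h2 _] := fLP (Ordinal id).
    + move=> i j ij; split; first by apply: le_trans bB; exact: WB.
      have id : (i < d)%N by apply: leq_ltn_trans ij; rewrite leqW// leq_addr.
      have jd : (j < d)%N by apply: leq_ltn_trans ij; rewrite leqW// leq_addl.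
      have := fwP (Ordinal id, Ordinal jd) ij.
      rewrite /param_slope !insubT/= ffunE opprB addrA; exact.
    + move=> i id; rewrite /e' /param_origin insubT/= ffunE.
      have := foP (Ordinal id) => /= h1; rewrite mulr2n mulrDl mul1r.
      by rewrite (le_trans (ler_normD _ _))// lerD ?He// distrC.
    + move=> i id; apply: le_trans Hrho _; rewrite ler_pM2r ?invr_gt0//.
      exact: lkV.
  by apply/rowP => i; rewrite !mxE /e' -/c; ring.
Qed.

End covering.

(** * Exceptional sets *)

Section exceptional_sets.
Context {R : realType} {d : nat}.
Variable mu : probability (borelRV R d) R.

Lemma markov_tp Q H f : tp d Q H f -> (forall x, 0 <= f x) ->
  let E := @cube R d `&` [set x | 1 / 2 <= f (coords x)] in
  measurable (E : set (borelRV R d)) /\ (mu E <= (2 * expect mu f)%:E)%E.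
Proof.
move=> Hf f0 E.
have mE : measurable (E : set (borelRV R d)).
  apply: measurable_closed; apply: closedI; first exact: closed_cube.
  rewrite (_ : [set x | _] = (fun x => f (coords x)) @^-1` [set y | 1 / 2 <= y]) //.
  apply: preimage_closed; last exact: closed_ge.
  by move=> x _; exact: (tp_continuous Hf).
split=> //.
have If : mu.-integrable (@cube R d) (EFin \o (fun x => 2 * f (coords x))).
  exact: tp_integrable (tp_scale 2 Hf).
have /integrableP[mf _] := If.
apply: (@le_trans _ _ (\int[mu]_(x in E) 1)%E).
  by rewrite (integral_cst mu mE) mul1e.
apply: (@le_trans _ _ (\int[mu]_(x in E) (2 * f (coords x))%:E)%E).
  apply: ge0_le_integral => //.
  - by apply: measurable_funS mf; [exact: measurable_cube|move=> x []].
  - by move=> x [_ /= fx]; rewrite lee_fin; lra.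
apply: (@le_trans _ _ (\int[mu]_(x in @cube R d) (2 * f (coords x))%:E)%E).
  apply: ge0_subset_integral => //; first exact: measurable_cube.
  - by move=> x _; rewrite lee_fin mulr_ge0.
  - by move=> x [].
rewrite /expect -(RintegralZl 2 measurable_cube (tp_integrable mu Hf)) /Rintegral fineK//.
exact: (integrable_fin_num measurable_cube If).
Qed.

Lemma markov_family (P : finType) (f : P -> (nat -> R) -> R) (eta : R) :
  (forall p, exists Q H, tp d Q H (f p)) -> (forall p x, 0 <= f p x) ->
  (forall p, expect mu (f p) <= eta) ->
  exists E : set (borelRV R d), [/\ measurable E,
    (mu E <= (#|P|%:R * (2 * eta))%:E)%E &
    forall x, @cube R d x -> ~ E x -> forall p, f p (coords x) < 1 / 2].
Proof.
move=> tpf f0 feta.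
pose E p := @cube R d `&` [set x | 1 / 2 <= f p (coords x)].
have mE p : measurable (E p : set (borelRV R d)).
  by have [Q [H Hf]] := tpf p; have [] := markov_tp Hf (f0 p).
exists (\big[setU/set0]_(p <- enum P) E p); split.
- by apply: bigsetU_measurable => p _.
- rewrite cardE; elim: (enum P) => [|p s IH].
    by rewrite big_nil measure0 mul0r.
  rewrite big_cons /= -natr1 mulrDl mul1r addrC EFinD.
  apply: (le_trans (measureU2 mu _ _)) => //; first by apply: bigsetU_measurable.
  apply: leeD => //; have [Q [H Hf]] := tpf p.
  apply: le_trans (markov_tp Hf (f0 p)).2 _.
  by rewrite lee_fin ler_pM2l.
- move=> x xc xE p; rewrite ltNge; apply/negP => fp; apply: xE.
  by rewrite -bigcup_seq; exists p; rewrite /= ?mem_enum.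
Qed.

Lemma prod_one_sub_ge M (u : nat -> R) (eps : R) : 0 <= eps <= 1 ->
  (forall j, (j < M)%N -> u j <= eps) -> 1 - M%:R * eps <= \prod_(j < M) (1 - u j).
Proof.
move=> /andP[e0 e1]; elim: M => [|M IH] ue; first by rewrite big_ord0 mul0r subr0.
rewrite big_ord_recr /=; have uM := ue M (ltnSn M).
have {}IH := IH (fun j jM => ue j (ltnW jM)).
have [h|h] := leP 0 (1 - M%:R * eps).
  apply: (@le_trans _ _ ((1 - M%:R * eps) * (1 - eps))).
    rewrite -natr1; have : 0 <= M%:R * eps * eps by rewrite mulr_ge0// mulr_ge0.
    lra.
  by rewrite ler_pM//; lra.
apply: (@le_trans _ _ 0).
  by rewrite -natr1; lra.
by rewrite mulr_ge0 ?prodr_ge0// => [j _|]; [have := ue j (ltnW (ltn_ord j))|]; lra.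
Qed.

(** If all values of [disc] along the orbit were at most [eps], the product of the [1 - disc] would
    be at least [1 - M eps >= 1/2], the level at which Markov's inequality is applied. *)
Lemma exceptional_set (F : R -> R) (m Q M : nat) (rho B v0 eps eta : R) (a delta : nat -> R) :
  mu (@cube R d) = 1%E ->
  (forall y, 0 <= F y) ->
  (forall y, \sum_(t < m.+1) F (y - t%:R / m.+1%:R) = 1) ->
  tp 1 (fun k => integral_freq m 1 k /\ nonzero 1 k) 1
     (fun x => F (x 0%N) - m.+1%:R^-1) ->
  (1 <= m)%N -> (forall j, 0 <= a j) -> (forall j, (4 * m%:R) * a j <= a j.+1) ->
  (forall j, 0 <= delta j) ->
  (forall j k p, large_freq (d := d) (a j / 2) k ->
    `|expect mu (fun x => cos (2 * pi * inner d k x + p))| <= delta j) ->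
  0 <= v0 -> 0 <= eps -> M%:R * eps <= 1 / 2 -> 0 <= eta ->
  (forall v, v0 <= v <= 1 ->
   (1 - v) ^+ M + \sum_(j < M) (1 + (3 * m.+1%:R) ^+ d) ^+ j.+1 * delta j <= eta) ->
  exists E : set (borelRV R d), [/\ measurable E,
    (mu E <= (#|{: param (d := d) Q}|%:R * (2 * eta))%:E)%E &
    forall x, @cube R d x -> ~ E x -> forall p : param (d := d) Q,
      (forall i, (i < d)%N -> (param_length p i <= m.+1)%N) ->
      v0 <= \prod_(i < d) ((param_length p i)%:R / m.+1%:R) ->
      exists2 j, (j < M)%N & eps < disc F m d (param_length p) (param_slope rho B p)
        (fun i => a j * coords x i - param_origin rho p i)].
Proof.
move=> mu1 F0 sumF Ftp m1 a0 aS delta0 hdelta v00 eps0 Meps eta0 Heta.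
pose good (p : param (d := d) Q) := (forall i, (i < d)%N -> (param_length p i <= m.+1)%N) /\
  v0 <= \prod_(i < d) ((param_length p i)%:R / m.+1%:R : R).
pose G (p : param (d := d) Q) j (x : nat -> R) := disc F m d (param_length p) (param_slope rho B p)
        (fun i => a j * x i - param_origin rho p i).
(* Codes that are not [good] get the function 0, which satisfies the hypotheses of [markov_family]
   trivially, so that the union bound runs over all codes. *)
pose f p x := if pselect (good p) then \prod_(j < M) (1 - G p j x) else 0.
have Gtp (p : param (d := d) Q) (gp : good p) j :
  tp d (fun k => bounded_freq (d := d) (m%:R * a j) k /\ large_freq (d := d) (a j) k)
    ((3 * m.+1%:R) ^+ d)
    (fun x => G p j x - \prod_(i < d) ((param_length p i)%:R / m.+1%:R)).
  have Htp := disc_tp (param_slope rho B p) Ftp gp.1.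
  apply: (tp_comp (h := fun x => (fun i => a j * x i - param_origin rho p i)) _ Htp).
  move=> k [km [i id ki]]; exists (fun i => a j * k i).
    split.
      move=> i' id'; have [_ _ ki'] := km i' id'.
      by rewrite normrM (ger0_norm (a0 j)) mulrC ler_wpM2r.
    exists i => //; rewrite normrM (ger0_norm (a0 j)) ler_peMr//.
    have [z kz _] := km i id; move: ki; rewrite kz intr_eq0 -normr_gt0 => z0.
    by rewrite -intr_norm -[1](mulr1z 1) ler_int -gtz0_ge1.
  exists (- inner d k (param_origin rho p)) => x.
  rewrite -mulN1r /inner mulr_sumr -big_split /=; apply: eq_bigr => i' _; ring.
have vp p (gp : good p) : v0 <= \prod_(i < d) ((param_length p i)%:R / m.+1%:R : R) <= 1.
  rewrite gp.2; apply: prodr_ile1 => i _; rewrite divr_ge0//= ler_pdivrMr// mul1r ler_nat.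
  exact: gp.1.
have G1 p (gp : good p) j x : G p j x <= 1 by apply: disc_le1 gp.1.
have [||p|E [mE muE HE]] := @markov_family _ f eta.
- move=> p; rewrite /f; case: pselect => [gp|ngp] /=; last first.
    by exists setT, 0; exact: tp0.
  have /andP[v1 v2] := vp p gp.
  have := prod_tp (v := \prod_(i < d) ((param_length p i)%:R / m.+1%:R)) _ m1 a0 aS (Gtp p gp).
  move=> /(_ _ M) h; eexists; eexists; apply: h.
  by rewrite v2 (le_trans v00).
- move=> p x; rewrite /f; case: pselect => //= gp.
  by apply: prodr_ge0 => j _; rewrite subr_ge0 G1.
- rewrite /f; case: pselect => [gp|ngp] /=; last by rewrite expect_cst.
  have /andP[v1 v2] := vp p gp.
  have v01 : 0 <= \prod_(i < d) ((param_length p i)%:R / m.+1%:R : R) <= 1.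
    by rewrite v2 (le_trans v00).
  by apply: le_trans (expect_prod mu1 v01 m1 a0 aS (Gtp p gp) delta0 hdelta M) (Heta _ (vp p gp)).
exists E; split=> // x xc nE p p1 p2.
have gp : good p by [].
have := HE x xc nE p; rewrite /f; case: pselect => //= _ lt12.
apply: contrapT => none; move: lt12; rewrite ltNge => /negP; apply.
have [->|M0] := posnP M; first by rewrite big_ord0; lra.
have e1 : eps <= 1.
  have : eps <= M%:R * eps by rewrite ler_peMl// ler1n.
  lra.
apply: le_trans (@prod_one_sub_ge M (fun j => G p j (coords x)) eps _ _); first lra.
  by rewrite eps0.
move=> j jM; rewrite leNgt; apply/negP => h; apply: none.
by exists j.
Qed.

End exceptional_sets.

(** * Choice of parameters *)

Section asymptotics.
Context {R : realType}.

Lemma one_sub_pow_le (y : R) k : 0 <= y <= 1 -> (1 - y) ^+ k * (1 + k%:R * y) <= 1.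
Proof.
move=> /andP[y0 y1]; elim: k => [|k IH]; first by rewrite mul0r addr0 mulr1.
apply: le_trans IH; rewrite exprSr -mulrA ler_wpM2l ?exprn_ge0 ?subr_ge0//.
rewrite -[k.+1%:R]natr1.
have : 0 <= (k%:R + 1) * y ^+ 2 by rewrite mulr_ge0 ?sqr_ge0// addr_ge0.
lra.
Qed.

(** A single Bernoulli bound [(1 - y)^m <= 1/(1 + m y)] cannot absorb the factor [m + 1]. So
    [m = 2k] and the bound for [k] is squared: [k y = 2 N^(2d+7)] yields [1/(4 N^(4d+14))], against
    [N d (m + 1) <= 3 N^(4d+13)]. *)
Lemma kernel_tail_le (d N m : nat) (rho : R) : (2 <= N)%N -> (d <= N)%N ->
  m = (2 * N ^ (4 * d + 11))%N -> rho = (N%:R ^+ (d + 2))^-1 ->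
  N%:R * (d%:R * (m.+1%:R * (1 - 2 * rho ^+ 2) ^+ m)) <= 1 / 2.
Proof.
have e1 : (4 * d + 11 = (2 * d + 7) + (d + 2) * 2)%N by lia.
have e2 : ((2 * d + 7) * 2 = 4 * d + 14)%N by lia.
have e3 : (4 * d + 14 = (4 * d + 11) + 3)%N by lia.
move=> N2 dN mE rhoE; set n : R := N%:R.
have n2 : 2 <= n by rewrite ler_nat.
have n0 : 0 < n by lra.
have ne k : 0 < n ^+ k by exact: exprn_gt0.
pose y := 2 * rho ^+ 2.
have rho12 : rho <= 1 / 2.
  rewrite rhoE -/n addn2 exprSr invfM -[leRHS]mul1r div1r ler_pM ?invr_ge0 ?(ltW (ne _)) ?(ltW n0)//.
    by rewrite invf_le1// exprn_ege1//; lra.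
  by rewrite lef_pV2 ?posrE//; lra.
have rho0 : 0 < rho by rewrite rhoE invr_gt0.
have y01 : 0 <= y <= 1.
  apply/andP; split; first by rewrite mulr_ge0// sqr_ge0.
  rewrite /y; nra.
pose k := (N ^ (4 * d + 11))%N.
have yk : k%:R * y = 2 * n ^+ (2 * d + 7).
  rewrite /y rhoE /k natrX -/n exprVn -exprM.
  by rewrite e1 exprD mulrCA -mulrA mulfV ?mulr1// gt_eqF.
have P1 := one_sub_pow_le k y01.
have yk0 : 0 < k%:R * y by rewrite yk mulr_gt0.
have P0 : 0 <= (1 - y) ^+ k by rewrite exprn_ge0//; lra.
have P2 : (1 - y) ^+ k <= (2 * n ^+ (2 * d + 7))^-1.
  rewrite -yk -[leRHS]mul1r ler_pdivlMr//; apply: le_trans P1.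
  by rewrite ler_wpM2l//; lra.
have P3 : (1 - y) ^+ m <= (4 * n ^+ (4 * d + 14))^-1.
  rewrite mE -/k mulnC exprM (le_trans (lerXn2r 2 _ _ P2))// ?nnegrE//.
    by rewrite invr_ge0 mulr_ge0// ltW.
  rewrite exprVn exprMn -exprM e2.
  by rewrite (_ : 2 ^+ 2 = 4 :> R)//; rewrite expr2 -natrM.
have m3 : m.+1%:R <= 3 * n ^+ (4 * d + 11).
  rewrite -[m.+1%:R]natr1 mE natrM natrX -/n.
  have : 1 <= n ^+ (4 * d + 11) by rewrite exprn_ege1//; lra.
  lra.
have dn : d%:R <= n by rewrite ler_nat.
have y0 : 0 <= 1 - 2 * rho ^+ 2 by move: y01; rewrite /y; lra.
apply: (@le_trans _ _ (n * (n * (3 * n ^+ (4 * d + 11) * (4 * n ^+ (4 * d + 14))^-1)))).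
  rewrite ler_pM2l//; apply: ler_pM => //.
    by rewrite mulr_ge0// exprn_ge0.
  by apply: ler_pM => //; rewrite exprn_ge0.
rewrite (_ : n ^+ (4 * d + 14) = n ^+ (4 * d + 11) * n ^+ 3); last by rewrite e3 exprD.
rewrite (_ : n * (n * _) = 3 / 4 / n).
  by rewrite ler_pdivrMr//; lra.
have := ne (4 * d + 11)%N; move: (n ^+ (4 * d + 11)) => u u0.
clearbody n; by field; rewrite !gt_eqF.
Qed.

Lemma ln_le_sqrt (x : R) : 1 <= x -> ln x <= 2 * Num.sqrt x.
Proof.
move=> x1; have x0 : 0 < x by lra.
have s0 : 0 < Num.sqrt x by rewrite sqrtr_gt0.
rewrite -{1}(sqr_sqrtr (ltW x0)) lnXn// mulr_natl ler_wMn2r//.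
have := @le_ln1Dx R (Num.sqrt x - 1); rewrite subrKC => h; have := h _; lra.
Qed.

Lemma ln_ge1 (x : R) : 4 <= x -> 1 <= ln x.
Proof.
move=> x4; have x0 : 0 < x by lra.
rewrite -(expRK 1) ler_ln ?posrE ?expR_gt0//; apply: le_trans x4.
have h : 1 / 2 <= expR (- (1 / 2)) :> R.
  by apply: le_trans (expR_ge1Dx _); lra.
have e2 : expR (1 / 2) <= 2 :> R.
  by have := expRxMexpNx_1 (1 / 2 : R); have := expR_ge0 (1 / 2 : R); nra.
rewrite (_ : 1 = 1 / 2 + 1 / 2 :> R) ?expRD; last by field.
by have := expR_ge0 (1 / 2 : R); nra.
Qed.

(** With [M = (N - 1) / l], rounded down, [N <= (M + 1) l]; moreover [l <= (c1 + 1) ln N <= N / 2],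
    by [ln N <= 2 sqrt N] and the lower bound on [N]. *)
Lemma lacunary_count (c1 : R) (N l : nat) : 0 <= c1 -> (4 <= N)%N ->
  16 * (c1 + 1) ^+ 2 <= N%:R -> l = (Num.trunc (c1 * ln N%:R)).+1 ->
  N%:R <= (N.-1 %/ l)%:R * (2 * (c1 + 1) * ln N%:R).
Proof.
move=> c0 N3 cN lE; set n : R := N%:R; set L := ln n.
have n3 : 4 <= n by rewrite ler_nat.
have L1 : 1 <= L by exact: ln_ge1.
have lL : l%:R <= (c1 + 1) * L.
  have /andP[h _] : (Num.trunc (c1 * L))%:R <= c1 * L < (Num.trunc (c1 * L)).+1%:R.
    by apply: truncn_itv; rewrite mulr_ge0//; lra.
  rewrite lE -[X in X <= _]natr1; lra.
have Ln : (c1 + 1) * L <= n / 2.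
  have n1 : 1 <= n by lra.
  have := ln_le_sqrt n1; rewrite -/L => h.
  have s0 := sqrtr_ge0 n.
  have ss : Num.sqrt n ^+ 2 = n by rewrite sqr_sqrtr//; lra.
  have : 4 * (c1 + 1) <= Num.sqrt n.
    rewrite -(ler_pXn2r (n := 2)) ?nnegrE//; last lra.
    by rewrite ss exprMn (_ : 4 ^+ 2 = 16 :> R)//; rewrite expr2 -natrM.
  move: (Num.sqrt n) s0 ss h => u u0 <- h1 h2; nra.
have lN : (N < (N.-1 %/ l).+1 * l + 1)%N.
  by have := @ltn_ceil N.-1 l; rewrite lE => /(_ isT); lia.
have : n <= ((N.-1 %/ l)%:R + 1) * l%:R.
  by rewrite natr1 -natrM ler_nat; lia.
have : (N.-1 %/ l)%:R * l%:R <= (N.-1 %/ l)%:R * ((c1 + 1) * L).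
  by rewrite ler_wpM2l.
lra.
Qed.

Lemma expRN_ln (N k : nat) : (0 < N)%N -> expR (- (k%:R * ln N%:R)) = (N%:R ^+ k)^-1 :> R.
Proof. by move=> N0; rewrite expRN expRM_natl lnK// posrE ltr0n. Qed.

End asymptotics.

(** * The Borel-Cantelli lemma with a telescoping bound *)

Section borel_cantelli.
Context d (T : measurableType d) (R : realType) (mu : {measure set T -> \bar R}).

Lemma ae_eventually_notin (E : nat -> set T) (c : R) : 0 <= c ->
  (forall k, measurable (E k)) ->
  (forall k, (mu (E k) <= (c / (k.+1%:R * k.+2%:R))%:E)%E) ->
  {ae mu, forall x, exists N0, forall N, (N0 <= N)%N -> ~ E N x}.
Proof.
move=> c0 mE Ec.
have mu0 : mu (lim_sup_set E) = 0%E.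
  apply: lim_sup_set_cvg0 => //.
  apply: (@le_lt_trans _ _ c%:E); last exact: ltry.
  apply: lime_le; first exact: is_cvg_nneseries.
  apply: nearW => n.
  (* The sum of [1 / ((k + 1) (k + 2))] telescopes, which gives the partial sums explicitly. *)
  apply: (@le_trans _ _ (c * (1 - n.+1%:R^-1))%:E); last first.
    by rewrite lee_fin ler_piMr// gerBl.
  elim: n => [|n IH]; first by rewrite big_geq// lee_fin invr1 subrr mulr0.
  rewrite big_nat_recr//=; apply: le_trans (leeD IH (Ec n)) _.
  rewrite -EFinD lee_fin -mulrDr ler_wpM2l// le_eqVlt; apply/orP; left; apply/eqP.
  rewrite -[n.+2%:R]natr1; have : 0 < n.+1%:R :> R by []; move: n.+1%:R => u u0.
  by field; apply/andP; split; rewrite gt_eqF//; lra.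
exists (lim_sup_set E); split=> //.
  apply: bigcap_measurable => // k _.
  by apply: bigcup_measurable => j /= _; exact: mE.
move=> x /= nx k _; apply: contrapT => H; apply: nx; exists k => N kN EN.
by apply: H; exists N.
Qed.

End borel_cantelli.

(** * Growth and Fourier decay along a lacunary sequence *)

Section lacunary.
Context {R : realType} {d : nat}.

Lemma lacunary_growth (a : nat -> nat) (r : R) : 1 < r ->
  (forall n, (1 <= n)%N -> r * (a n)%:R <= (a n.+1)%:R) ->
  forall n k, (1 <= n)%N -> r ^+ k * (a n)%:R <= (a (n + k)%N)%:R.
Proof.
move=> r1 ra n k n1; elim: k => [|k IH]; first by rewrite mul1r addn0.
rewrite addnS; apply: le_trans (ra (n + k)%N _); last by rewrite (leq_trans n1)// leq_addr.
by rewrite exprS -mulrA ler_wpM2l//; lra.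
Qed.

Lemma frac_shift (x y : R) (k : int) : 0 <= y < 1 -> x = y + k%:~R -> Defs.frac x = y.
Proof.
move=> y01 ->; rewrite /Defs.frac (_ : Num.floor _ = k) ?addrK//.
by apply/eqP; rewrite floor_eq intrD; lra.
Qed.

Variable mu : probability (borelRV R d) R.

Lemma expect_cos_decay (nrm : 'rV[R]_d -> R) (A Ups c : R) k p D :
  (forall k D, 0 <= D -> large_freq (d := d) D k -> c * D <= nrm (\row_i k i)) ->
  (forall x : 'rV[R]_d, Normc.normc (fourier mu x) <= A * (1 + nrm x) `^ (- Ups)) ->
  0 < A -> 0 < Ups -> 0 < c -> 0 < D -> large_freq (d := d) D k ->
  `|expect mu (fun x => cos (2 * pi * inner d k x + p))| <= 2 * A * ((c * D) `^ Ups)^-1.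
Proof.
move=> cP decay A0 U0 c0 D0 kD.
apply: le_trans (expect_cos_fourier mu k p) _; rewrite -mulrA ler_pM2l//.
apply: le_trans (decay _) _; rewrite ler_pM2l// powRN.
have cD := cP k D (ltW D0) kD.
have cD0 : 0 < c * D by rewrite mulr_gt0.
rewrite lef_pV2 ?posrE ?powR_gt0//; last by lra.
by apply: ge0_ler_powR; rewrite ?nnegrE ?(ltW U0)//; lra.
Qed.

End lacunary.

Section decay.
Context {R : realType}.

(** Raising [(1 + H) z <= X^Ups] to the power [j + 1] shows that decay at frequencies of order
    [a >= X^(j+1)] beats the coefficients [(1 + H)^(j+1)], with a factor [z] to spare for every
    [j]. *)
Lemma decay_term (A Ups c X H z a : R) (j : nat) :
  0 < A -> 0 < Ups -> 0 < c -> 0 < X -> 0 <= H -> 1 <= z -> X ^+ j.+1 <= a ->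
  (1 + H) * z <= X `^ Ups ->
  (1 + H) ^+ j.+1 * (2 * A * ((c * (a / 2)) `^ Ups)^-1) <=
  2 * A * ((c / 2) `^ Ups)^-1 / z.
Proof.
move=> A0 U0 c0 X0 H0 z1 Xa HX; have z0 : 0 < z by lra.
have Xj : 0 < X ^+ j.+1 by rewrite exprn_gt0.
have a0 : 0 < a by exact: lt_le_trans Xa.
rewrite (_ : c * (a / 2) = c / 2 * a); last by ring.
rewrite powRM; [|by rewrite divr_ge0// ltW|exact: ltW].
have aU : (1 + H) ^+ j.+1 * z <= a `^ Ups.
  apply: (@le_trans _ _ ((X `^ Ups) ^+ j.+1)).
    apply: (@le_trans _ _ (((1 + H) * z) ^+ j.+1)).
      rewrite exprMn ler_wpM2l ?exprn_ge0//; first lra.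
      by rewrite exprS ler_peMr ?exprn_ege1//; lra.
    by rewrite lerXn2r ?nnegrE ?powR_ge0// mulr_ge0//; lra.
  rewrite -powR_mulrn ?powR_ge0// powRAC powR_mulrn; last exact: ltW.
  by apply: ge0_ler_powR; rewrite ?nnegrE ?(ltW U0) ?(ltW Xj) ?(ltW a0).
have aU0 : 0 < a `^ Ups by exact: powR_gt0.
have cU0 : 0 < (c / 2) `^ Ups by rewrite powR_gt0// divr_gt0.
move: ((1 + H) ^+ j.+1) (a `^ Ups) ((c / 2) `^ Ups) aU aU0 cU0 => u v w uv v0 w0.
rewrite (_ : u * _ = 2 * A / w * (u / v)); last by field; rewrite !gt_eqF.
rewrite ler_pM2l; last by rewrite divr_gt0// mulr_gt0.
by rewrite ler_pdivrMr// mulrC ler_pdivlMr.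
Qed.

End decay.

(** * Inequalities between powers of N *)

Section parameters.
Context {R : realType}.
Variables (d N s m : nat).
Hypotheses (N9 : (9 <= N)%N) (mE : m = (2 * N ^ s)%N).
Local Notation n := (N%:R : R).

Let n9 : 9 <= n. Proof. by rewrite ler_nat. Qed.

Let n0 : 0 < n. Proof. by apply: lt_le_trans n9. Qed.

Let pn k : 0 < n ^+ k. Proof. by rewrite exprn_gt0. Qed.

Let pn1 k : 1 <= n ^+ k.
Proof. by rewrite exprn_ege1// (le_trans _ n9)// ler1n. Qed.

Let pnle i j : (i <= j)%N -> n ^+ i <= n ^+ j.
Proof. by move=> ij; rewrite ler_weXn2l// (le_trans _ n9)// ler1n. Qed.

Let mR : m%:R = 2 * n ^+ s. Proof. by rewrite mE natrM natrX. Qed.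

Lemma degree_le : 4 * m%:R <= n ^+ (s + 3).
Proof.
rewrite mR exprD mulrA mulrC ler_pM2l// -natrM.
by rewrite (le_trans _ (pnle (isT : (1 <= 3)%N)))// expr1 (le_trans _ n9)// ler_nat.
Qed.

Lemma coefficients_le : 1 + (3 * m.+1%:R) ^+ d <= n ^+ ((s + 1) * d + 1).
Proof.
(* Here [3 (m + 1) = 6 N^s + 3 <= 9 N^s], and [9 <= N] absorbs the constant. *)
have m9 : 3 * m.+1%:R <= n ^+ (s + 1).
  rewrite -[m.+1%:R]natr1 mR addn1 exprSr.
  have : n ^+ s * 9 <= n ^+ s * n by rewrite ler_pM2l.
  by have := pn1 s; lra.
rewrite addn1 exprSr exprM.
have h : (3 * m.+1%:R) ^+ d <= (n ^+ (s + 1)) ^+ d.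
  by rewrite lerXn2r ?nnegrE ?mulr_ge0// ltW.
have h1 : 1 <= (n ^+ (s + 1)) ^+ d by rewrite exprn_ege1.
have : (n ^+ (s + 1)) ^+ d * 9 <= (n ^+ (s + 1)) ^+ d * n.
  by rewrite ler_pM2l// exprn_gt0.
by lra.
Qed.

Lemma radius_le (rho : R) : rho = (n ^+ (d + 2))^-1 -> 0 <= 1 - 2 * rho ^+ 2.
Proof.
move=> ->; have : (n ^+ (d + 2))^-1 <= 2^-1.
  rewrite lef_pV2 ?posrE// (le_trans _ (pnle (leq_addl d 2)))//.
  by rewrite (le_trans _ (pnle (isT : (1 <= 2)%N)))// expr1 (le_trans _ n9)// ler_nat.
have : 0 < (n ^+ (d + 2))^-1 by rewrite invr_gt0.
by move: (n ^+ _)^-1 => u; nra.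
Qed.

(** As [V >= 1/N], slopes are at most [b N] and the shear amplifies errors by at most a constant
    times [N^d]. The remaining factor [N^(-2)] of [rho] leaves one power for sides of order [1/N]
    and one for the constants. *)
Lemma covering_conditions (ka b V rho : R) (Q : nat) : 0 < ka -> 0 <= b ->
  2 * b + 1 <= n -> 2 * ka^-1 <= n -> 16 * (2 * (1 + b)) ^+ d / ka <= n ->
  n^-1 <= V -> (d + 2 <= s)%N -> rho = (n ^+ (d + 2))^-1 -> Q = (N ^ (s + 2))%N ->
  [/\ b / V <= b * n, (2 * (1 + b * n)) ^+ d * (2 * rho) * 2 <= ka * V / 4,
    4 <= m.+1%:R * (ka * V), (m.+1 < Q)%N &
    rho^-1 + 1 <= Q%:R /\ 2 * (b * n) / rho + 1 <= Q%:R].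
Proof.
move=> ka0 b0 nb nka nbig nV ds rhoE QE.
have V0 : 0 < V by apply: lt_le_trans nV; rewrite invr_gt0.
have rho0 : 0 < rho by rewrite rhoE invr_gt0.
have QR : Q%:R = n ^+ s * n * n by rewrite QE natrX exprD expr2 mulrA.
have h9 : n ^+ s * 9 <= n ^+ s * n by rewrite ler_pM2l.
have h81 : n ^+ s * n * 9 <= n ^+ s * n * n by rewrite ler_pM2l// mulr_gt0.
have hd : n ^+ (d + 2) <= n ^+ s by exact: pnle.
have h1 := pn1 s.
split.
- by rewrite ler_wpM2l// -[leRHS]invrK lef_pV2 ?posrE ?invr_gt0.
- apply: (@le_trans _ _ ((2 * (1 + b) * n) ^+ d * (2 * rho) * 2)).
    rewrite ler_pM2r// ler_wpM2r//; first by rewrite mulr_ge0// ltW.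
    rewrite lerXn2r ?nnegrE//; first by rewrite mulr_ge0// addr_ge0// mulr_ge0.
      by rewrite mulr_ge0// mulr_ge0// addr_ge0.
    by rewrite -mulrA ler_pM2l// mulrDl mul1r lerD2r (le_trans _ n9)// ler1n.
  apply: (@le_trans _ _ (ka * n^-1 / 4)); last first.
    by rewrite ler_pM2r ?invr_gt0// ler_pM2l.
  rewrite exprMn rhoE exprD invfM.
  rewrite (_ : _ * _ * 2 = (16 * (2 * (1 + b)) ^+ d / ka) * ka / 4 * (n ^+ 2)^-1).
    rewrite (_ : ka / n / 4 = n * ka / 4 * (n ^+ 2)^-1).
      by rewrite ler_pM2r ?invr_gt0// ler_pM2r// ler_pM2r.
    by field; rewrite gt_eqF.
  have := pn d; move: (n ^+ d) (_ ^+ d) => u u' u0.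
  by field; rewrite !gt_eqF.
- apply: (@le_trans _ _ (2 * n ^+ 2 * (ka * n^-1))).
    rewrite (_ : 2 * n ^+ 2 * _ = 2 * (n * ka)); last by field; rewrite gt_eqF.
    have : 2 <= n * ka by rewrite -ler_pdivrMr.
    by lra.
  apply: ler_pM; [by rewrite mulr_ge0// ltW|by rewrite mulr_ge0 ?invr_ge0// ltW| |].
    by rewrite -[m.+1%:R]natr1 mR; have := pnle (leq_trans (leq_addl d 2) ds); lra.
  by rewrite ler_pM2l.
- by rewrite -(ltr_nat R) QR -[m.+1%:R]natr1 mR; lra.
- rewrite QR rhoE !invrK; split; first by lra.
  have h3 : n * n ^+ (d + 2) <= n ^+ s * n by rewrite mulrC ler_pM2r.
  have h5 : 1 <= n ^+ s * n by lra.
  have h6 : 2 * b * (n * n ^+ (d + 2)) <= 2 * b * (n ^+ s * n).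
    by rewrite ler_wpM2l// mulr_ge0.
  have h7 : (2 * b + 1) * (n ^+ s * n) <= n * (n ^+ s * n) by rewrite ler_pM2r// mulr_gt0.
  move: h5 h6 h7; rewrite [n * (n ^+ s * n)]mulrC.
  rewrite (_ : 2 * (b * n) * _ = 2 * b * (n * n ^+ (d + 2))); last by ring.
  by move: (n ^+ s * n) (n ^+ s * n * n) => u v; lra.
Qed.

Lemma gap_growth (r : R) (x l : nat) : 1 < r ->
  l = (Num.trunc (x%:R / ln r * ln n)).+1 -> n ^+ x <= r ^+ l.
Proof.
move=> r1 lE; have r0 : 0 < r by apply: lt_trans r1.
have -> : n ^+ x = expR (x%:R * ln n) by rewrite expRM_natl lnK.
have -> : r ^+ l = expR (l%:R * ln r) by rewrite expRM_natl lnK.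
rewrite ler_expR -ler_pdivrMr ?ln_gt0// lE (le_trans _ (ltW (truncnS_gt _)))//.
by rewrite mulrAC.
Qed.

(** [(1 - v)^M] is at most [exp(- M v0)], and [M v0] is at least a multiple of [C ln N], since the
    gaps between indices consume one of the two logarithms in [v0]. The summand 1 of [C] serves to
    get [V >= 1/N] in [exceptional_sets_exist]. *)
Lemma miss_le (kv c1 v v0 C : R) (M k : nat) : 0 < kv -> 0 <= c1 ->
  C = 1 + 2 * (c1 + 1) * k%:R / kv -> v0 = kv * (C * ln n ^+ 2 / n) ->
  n <= M%:R * (2 * (c1 + 1) * ln n) -> v0 <= v <= 1 ->
  (1 - v) ^+ M <= (n ^+ k)^-1.
Proof.
move=> kv0 c10 CE v0E nM /andP[v0v v1].
have L1 : 1 <= ln n by apply: ln_ge1; apply: le_trans n9; rewrite ler_nat.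
move: (ln n) L1 v0E nM (@expRN_ln R N k (leq_trans (isT : (0 < 9)%N) N9)) => L L1 v0E nM <-.
have C0 : 0 <= C.
  by rewrite CE addr_ge0// divr_ge0 ?(ltW kv0)// mulr_ge0// mulr_ge0// addr_ge0.
have L0 : 0 < L by apply: lt_le_trans L1.
apply: (@le_trans _ _ (expR (- v) ^+ M)).
  by rewrite lerXn2r ?nnegrE ?expR_ge0 ?expR_ge1Dx// subr_ge0.
rewrite -expRM_natl ler_expR mulrN lerN2.
apply: (@le_trans _ _ (M%:R * v0)); last by rewrite ler_wpM2l.
pose t := 2 * (c1 + 1) * L.
have c1p : 0 < 2 * (c1 + 1) by rewrite mulr_gt0// ltr_wpDl.
have t0 : 0 < t by rewrite mulr_gt0.
apply: (@le_trans _ _ (n / t * v0)).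
  rewrite (_ : n / t * v0 = (C * kv / (2 * (c1 + 1))) * L).
    rewrite ler_pM2r// ler_pdivlMr// (_ : C * kv = kv + 2 * (c1 + 1) * k%:R).
      by rewrite mulrC lerDr ltW.
    by rewrite CE; field; rewrite gt_eqF.
  by rewrite v0E /t; field; rewrite !gt_eqF// ltr_wpDl.
rewrite ler_wpM2r// ?ler_pdivrMr// v0E mulr_ge0 ?(ltW kv0)//.
by rewrite divr_ge0 ?(ltW n0)// mulr_ge0// sqr_ge0.
Qed.

End parameters.

(** * Exceptional sets of measure O(1/N^2) *)

Section main_step.
Context {R : realType} {d : nat}.

Lemma card_param Q : #|{: param (d := d) Q}| = (Q ^ (d + d + d * d))%N.
Proof. by rewrite card_ffun card_ord !card_sum card_prod !card_ord. Qed.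

(** Fractional parts lie in [[0, 1)], whereas [K] may touch the faces of the cube at 1. Moving the
    point found by [rho] in every coordinate stays in [K], so its coordinates are at most [1 - rho]
    and it equals its reduction modulo 1. *)
Lemma disc_hit (F : R -> R) (m : nat) (rho eps : R) L W (o : nat -> R)
    (K : set 'rV[R]_d) (alpha : 'rV[R]_d) (k : nat) :
  (forall y, 0 <= F y) ->
  (forall y, \sum_(t < m.+1) F (y - t%:R / m.+1%:R) = 1) ->
  0 <= eps -> 0 < rho ->
  (forall y, (forall k : int, rho < `|y - k%:~R|) -> F y <= eps) ->
  (forall i, (i < d)%N -> (L i <= m.+1)%N) ->
  K `<=` @cube R d ->
  (forall y e, near_disc m rho d L W y -> (forall i, (i < d)%N -> `|e i| <= rho) ->
      K (\row_i (o i + y i + e i))) ->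
  d%:R * (m.+1%:R * eps) < disc F m d L W (fun i => k%:R * coords alpha i - o i) ->
  K (dilate_mod1 alpha k).
Proof.
move=> F0 sumF eps0 rho0 Ftail Lm Kcube HK.
move=> /(disc_gt_near F0 sumF eps0 Ftail Lm)[y ny xy].
have HKc e0 : `|e0| <= rho -> K (\row_i (o i + y i + e0)).
  by move=> e0r; apply: HK.
have K0 := HKc 0; rewrite normr0 in K0; have {}K0 := K0 (ltW rho0).
rewrite (_ : dilate_mod1 alpha k = \row_i (o i + y i + 0))//.
apply/rowP => i; rewrite !mxE addr0.
have [z zE] := xy i (ltn_ord i).
apply: (@frac_shift _ _ _ z).
  have /Kcube /(_ i) := K0; rewrite mxE addr0 => /andP[h0 _].
  have /HKc /Kcube /(_ i) : `|rho| <= rho by rewrite ger0_norm// ltW.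
  by rewrite mxE => /andP[_ h1]; lra.
by move: zE; rewrite coords_ord mulrC; lra.
Qed.

Lemma exceptional_sets_exist (r Ups : R) : 1 < r -> 0 < Ups ->
  exists2 C : R, 0 < C &
  forall (nrm : 'rV[R]_d -> R) (a : nat -> nat)
      (mu : probability (borelRV R d) R) (A : R),
    is_norm nrm ->
    (forall n, (1 <= n)%N -> (0 < a n)%N) ->
    (forall n, (1 <= n)%N -> r * (a n)%:R <= (a n.+1)%:R) ->
    mu (@cube R d) = 1%E ->
    0 < A ->
    (forall x : 'rV[R]_d,
       Normc.normc (fourier mu x) <= A * (1 + nrm x) `^ (- Ups)) ->
  exists N1 : nat, exists2 c : R, 0 <= c & forall N, (N1 <= N)%N ->
  exists E : set (borelRV R d), [/\ measurable E,
    (mu E <= (c / N%:R ^+ 2)%:E)%E &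
    forall alpha, @cube R d alpha -> ~ E alpha ->
    forall K : set 'rV[R]_d, convex_body K -> K `<=` @cube R d ->
         ((C * ln N%:R ^+ 2 / N%:R)%:E <= Vol K)%E ->
         exists2 n : nat, (1 <= n <= N)%N & K (dilate_mod1 alpha (a n))].
Proof.
move=> r1 U0.
have [[ka b] /= [ka0 b0 cov]] := @covering R d.
(* There are [N^tau] codes, so each may fail with probability [O(N^(-tau-2))]. The at most [N] error
   terms of [expect_prod] must then be [O(N^(-tau-3))] each, against coefficients governed by
   [N^hx]; hence [w], and a gap [r^l >= N^x] with [x Ups >= w]. The summand [s + 3] of [x] provides
   the growth factor [4 m]. *)
pose s := (4 * d + 11)%N; pose tau := ((s + 2) * (d + d + d * d))%N.
pose hx := ((s + 1) * d + 1)%N; pose w := (hx + (tau + 3))%N.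
pose x := (s + 3 + (Num.trunc (w%:R / Ups)).+1)%N.
have xU : w%:R <= x%:R * Ups.
  rewrite -ler_pdivrMr// (le_trans (ltW (truncnS_gt _)))// ler_nat.
  exact: leq_addl.
have sx : (s + 3 <= x)%N by exact: leq_addr.
have lnr0 : 0 < ln r by rewrite ln_gt0.
pose c1 := x%:R / ln r.
have c10 : 0 <= c1 by rewrite divr_ge0// ltW.
pose kv := ka / 4 ^+ d.
have kv0 : 0 < kv by rewrite divr_gt0// exprn_gt0.
pose C0 := 2 * (c1 + 1) * (tau + 2)%:R / kv.
have C00 : 0 <= C0.
  by rewrite divr_ge0 ?(ltW kv0)// mulr_ge0// mulr_ge0// addr_ge0.
pose C := 1 + C0.
have C_gt0 : 0 < C by rewrite /C; lra.
exists C => //.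
move=> nrm a mu A nN apos alac mu1 A0 decay.
have [c0 c00 cP] := norm_lower_bound nN.
pose A' := 2 * A * ((c0 / 2) `^ Ups)^-1.
have A'0 : 0 <= A' by rewrite mulr_ge0 ?invr_ge0 ?powR_ge0// mulr_ge0// ltW.
pose big1 := 16 * (2 * (1 + b)) ^+ d / ka.
have big10 : 0 <= big1.
  by rewrite divr_ge0 ?(ltW ka0)// mulr_ge0// exprn_ge0//; lra.
pose big2 := 16 * (c1 + 1) ^+ 2.
have big20 : 0 <= big2 by rewrite mulr_ge0// sqr_ge0.
have ka1 : 0 <= ka^-1 by rewrite invr_ge0 ltW.
(* The threshold for [N] involves neither [A] nor the norm; these enter only through [A'], in the
   constant of the measure bound. *)
pose bigc := 9 + d%:R + 2 * b + 2 * ka^-1 + big1 + big2.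
exists (Num.trunc bigc).+1, (2 * (1 + A')); first by rewrite mulr_ge0//; lra.
move=> N NN; set n : R := N%:R.
have nbig : bigc <= n.
  by rewrite (le_trans (ltW (truncnS_gt _)))// ler_nat.
have d0 : 0 <= d%:R :> R by [].
have n9 : 9 <= n by rewrite /bigc in nbig; lra.
have nd : d%:R <= n by rewrite /bigc in nbig; lra.
have nb : 2 * b + 1 <= n by rewrite /bigc in nbig; lra.
have nka : 2 * ka^-1 <= n by rewrite /bigc in nbig; lra.
have nbig1 : big1 <= n by rewrite /bigc in nbig; lra.
have nbig2 : big2 <= n by rewrite /bigc in nbig; lra.
have n0 : 0 < n by lra.
have n1 : 1 <= n by lra.
have N9 : (9 <= N)%N by rewrite -(ler_nat R).
have dN : (d <= N)%N by rewrite -(ler_nat R).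
have N0 : (0 < N)%N by apply: leq_trans N9.
have pn k : 0 < n ^+ k by rewrite exprn_gt0.
clear nbig NN.
pose L := ln n; have L1 : 1 <= L by apply: ln_ge1; lra.
pose l := (Num.trunc (c1 * L)).+1; pose M := (N.-1 %/ l)%N.
have nM : n <= M%:R * (2 * (c1 + 1) * L).
  by apply: (lacunary_count c10 _ nbig2) => //; apply: leq_trans N9.
pose m := (2 * N ^ s)%N.
pose rho := (n ^+ (d + 2))^-1; have rho0 : 0 < rho by rewrite invr_gt0.
pose B := b * n; pose Q := (N ^ (s + 2))%N.
pose V := C * L ^+ 2 / n; pose v0 := kv * V.
have Vn : n^-1 <= V.
  rewrite -[leLHS]mul1r ler_pM2r ?invr_gt0// -[leLHS]mulr1.
  by apply: ler_pM => //; [rewrite lerDl|rewrite exprn_ege1].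
have V0 : 0 < V by apply: lt_le_trans Vn; rewrite invr_gt0.
pose eps0 := (1 - 2 * rho ^+ 2) ^+ m.
pose eps := d%:R * (m.+1%:R * eps0).
have tail_le := @kernel_tail_le R d N m rho (ltnW (leq_trans _ N9)) dN erefl erefl.
have {}tail_le : n * eps <= 1 / 2 by apply: tail_le.
have eps00 : 0 <= eps0 by rewrite exprn_ge0// (radius_le N9 (d := d)).
have eps_ge0 : 0 <= eps by rewrite mulr_ge0// mulr_ge0.
pose X := r ^+ l.
have Xn : n ^+ x <= X by exact: gap_growth.
have X0 : 0 < X by apply: lt_le_trans Xn.
(* Indices start at [1 + l], not at 1: the first term is then already at least [X], as the decay
   bound for [j = 0] requires. *)
pose a_ j : R := (a (1 + j.+1 * l)%N)%:R.
have aX j : X ^+ j.+1 <= a_ j.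
  have := lacunary_growth r1 alac (j.+1 * l) (leqnn 1).
  apply: le_trans; rewrite mulnC exprM -/X; apply: ler_peMr.
    by rewrite exprn_ge0// ltW.
  by rewrite ler1n apos.
have aS j : X * a_ j <= a_ j.+1.
  have := @lacunary_growth R a r r1 alac (1 + j.+1 * l) l (leq_addr _ _).
  by rewrite -addnA -[(j.+1 * l + l)%N]mulSnr.
have a_gt0 j : 0 < a_ j by rewrite (lt_le_trans _ (aX j))// exprn_gt0.
have a_ge0 j : 0 <= a_ j by exact: ltW.
have aS4 j : (4 * m%:R) * a_ j <= a_ j.+1.
  apply: le_trans (aS j); rewrite ler_wpM2r// (le_trans _ Xn)//.
  apply: le_trans (degree_le N9 (erefl m)) _.
  by rewrite ler_weXn2l.
pose H := (3 * m.+1%:R : R) ^+ d.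
have H0 : 0 <= H by rewrite exprn_ge0// mulr_ge0.
have Hn : 1 + H <= n ^+ hx by exact: (coefficients_le d N9 (erefl m)).
have HX : (1 + H) * n ^+ (tau + 3) <= X `^ Ups.
  apply: (@le_trans _ _ (n ^+ w)).
    by rewrite [leRHS]exprD ler_pM2r.
  apply: (@le_trans _ _ (n `^ (x%:R * Ups))).
    by rewrite -powR_mulrn ?(ltW n0)// ler_powR.
  rewrite powRrM powR_mulrn ?(ltW n0)//.
  by apply: ge0_ler_powR; rewrite ?nnegrE ?(ltW U0) ?(ltW X0) ?(ltW (pn _)).
pose delta j := 2 * A * ((c0 * (a_ j / 2)) `^ Ups)^-1.
have delta0 j : 0 <= delta j.
  by rewrite mulr_ge0 ?invr_ge0 ?powR_ge0// mulr_ge0// ltW.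
pose eta := (1 + A') / n ^+ (tau + 2).
have eta0 : 0 <= eta by rewrite divr_ge0 ?(ltW (pn _))// addr_ge0.
have MN : (M <= N)%N by rewrite (leq_trans (leq_div _ _))// leq_pred.
have Mn : M%:R <= n by rewrite ler_nat.
have [F [F0 sumF Ftp Ftail]] := @kernel_exists R m.
have v00 : 0 <= v0 by rewrite mulr_ge0// ltW.
have Heta v : v0 <= v <= 1 ->
    (1 - v) ^+ M + \sum_(j < M) (1 + H) ^+ j.+1 * delta j <= eta.
  move=> /andP[v0v v1]; rewrite /eta mulrDl mul1r lerD//.
    by apply: (miss_le N9 kv0 c10 (erefl C) (erefl v0) nM); rewrite v0v.
  apply: (@le_trans _ _ (\sum_(j < M) (A' / n ^+ (tau + 3)))).
    apply: ler_sum => j _; by apply: (decay_term (X := X)) (aX j) HX => //; rewrite exprn_ege1.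
  rewrite sumr_const card_ord -[_ *+ M]mulr_natl.
  apply: (@le_trans _ _ (n * (A' / n ^+ (tau + 3)))).
    by rewrite ler_wpM2r// divr_ge0 // ltW.
  rewrite (_ : (tau + 3 = (tau + 2).+1)%N) ?exprS; last by rewrite addnS.
  rewrite le_eqVlt; apply/orP; left; apply/eqP.
  have := pn (tau + 2)%N; move: (n ^+ (tau + 2)) => u u0.
  by field; rewrite !gt_eqF.
have m1 : (1 <= m)%N by rewrite muln_gt0 expn_gt0 N0.
have [||E [mE' muE HE]] := @exceptional_set R d mu F m Q M rho B v0 eps eta a_ delta
  mu1 F0 sumF Ftp m1 a_ge0 aS4 delta0 _ v00 eps_ge0 _ eta0 Heta.
- move=> j k p kl; apply: (expect_cos_decay _ cP decay) => //.
  by rewrite divr_gt0.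
- by apply: le_trans tail_le; rewrite ler_wpM2r.
exists E; split=> //.
  apply: le_trans muE _; rewrite lee_fin card_param /Q -expnM -/tau natrX -/n /eta.
  rewrite exprD le_eqVlt; apply/orP; left; apply/eqP.
  have := pn tau; move: (n ^+ tau) => u u0.
  by field; rewrite !gt_eqF.
move=> alpha calpha nE K cK Kcube VK.
have ds : (d + 2 <= s)%N by rewrite /s leq_add// leq_pmull.
have [bVB cond1 cond2 cond3 [cond4 cond5]] :=
  covering_conditions N9 (erefl m) ka0 b0 nb nka nbig1 Vn ds (erefl rho) (erefl Q).
have [p [pL pv pK]] := cov K V m Q rho B cK Kcube V0 VK bVB rho0 cond1 cond2 cond3 cond4 cond5.
have [j jM hit] := HE alpha calpha nE p pL pv.
exists (1 + j.+1 * l)%N.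
  rewrite leq_addr /= add1n -[leqRHS](prednK N0) ltnS.
  by rewrite (leq_trans _ (leq_trunc_div N.-1 l))// leq_mul2r jM orbT.
apply: (disc_hit (alpha := alpha) (k := a (1 + j.+1 * l)) F0 sumF eps00 rho0 _ pL Kcube pK hit).
by move=> y; apply: Ftail; exact: ltW.
Qed.

End main_step.

Theorem theorem1 (R : realType) (d : nat) (r Ups : R)
    (hd : (1 <= d)%N) (hr : 1 < r) (hUps : 0 < Ups) :
  exists2 C : R, 0 < C &
  forall (nrm : 'rV[R]_d -> R) (a : nat -> nat)
      (mu : probability (borelRV R d) R) (A : R),
    is_norm nrm ->
    (forall n, (1 <= n)%N -> (0 < a n)%N) ->
    (forall n, (1 <= n)%N -> r * (a n)%:R <= (a n.+1)%:R) ->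
    mu (@cube R d) = 1%E ->
    0 < A ->
    (forall x : 'rV[R]_d,
       Normc.normc (fourier mu x) <= A * (1 + nrm x) `^ (- Ups)) ->
    {ae mu, forall alpha : 'rV[R]_d, @cube R d alpha ->
       exists N0 : nat, forall N : nat, (N0 <= N)%N ->
       forall K : set 'rV[R]_d, convex_body K -> K `<=` @cube R d ->
         ((C * ln N%:R ^+ 2 / N%:R)%:E <= Vol K)%E ->
         exists2 n : nat, (1 <= n <= N)%N & K (dilate_mod1 alpha (a n))}.
Proof.
have [C C0 step] := @exceptional_sets_exist R d r Ups hr hUps.
exists C => // nrm a mu A nN apos alac mu1 A0 decay.
have [N1 [c c0 HE]] := step nrm a mu A nN apos alac mu1 A0 decay.
(* From 2 on, [(N + 1) (N + 2) <= 4 N^2], which turns [c / N^2] into the bound that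
   [ae_eventually_notin] expects; below [N2] the empty set is taken. *)
pose N2 := maxn N1 2.
have ex N : exists E : set (borelRV R d), [/\ measurable E,
    (mu E <= (4 * c / (N.+1%:R * N.+2%:R))%:E)%E &
    (N2 <= N)%N -> forall alpha, @cube R d alpha -> ~ E alpha ->
    forall K : set 'rV[R]_d, convex_body K -> K `<=` @cube R d ->
         ((C * ln N%:R ^+ 2 / N%:R)%:E <= Vol K)%E ->
         exists2 n : nat, (1 <= n <= N)%N & K (dilate_mod1 alpha (a n))].
  have [N2N|N2N] := leqP N2 N; last first.
    by exists set0; split=> //; rewrite measure0 lee_fin divr_ge0// mulr_ge0.
  have [N1N N2' ] : (N1 <= N)%N /\ (2 <= N)%N by apply/andP; rewrite -geq_max.
  have [E [mE muE hE]] := HE N N1N.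
  exists E; split=> //; apply: le_trans muE _; rewrite lee_fin.
  have n2 : 2 <= N%:R :> R by rewrite ler_nat.
  rewrite -[N.+2%:R]natr1 -[N.+1%:R]natr1; move: (N%:R : R) n2 => n n2.
  rewrite [4 * c]mulrC -mulrA ler_wpM2l// ler_pdivlMr; last by nra.
  by rewrite mulrC ler_pdivrMr; nra.
have [E EP] := choice ex.
have := @ae_eventually_notin _ _ _ mu E (4 * c) (mulr_ge0 (ler0n _ _) c0)
  (fun k => let: And3 h _ _ := EP k in h) (fun k => let: And3 _ h _ := EP k in h).
apply: filterS => alpha [N0 nE] calpha; exists (maxn N0 N2) => N.
rewrite geq_max => /andP[N0N N2N].
by have [_ _ h] := EP N; exact: (h N2N alpha calpha (nE N N0N)).
Qed.
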